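(* Let $m\ge 2$ and $\tilde H\le 0$. For $r>0$ and a function $\Phi$ put $$I_\alpha(r):=\frac{1}{r^{n-\alpha}}\int_{B_r}\left[\sum_{i=1}^m\Phi(|\nabla u_i|^2)-2\tilde H(u)\right].$$ (i) Let $\Phi(s)=s$ and let $u=(u_i)_{i=1}^m$ be a classical solution of $-\Delta u_i=H_i(u)$ in $\mathbb{R}^n$, $i=1,\dots,m$. Then for all $\alpha\ge 2$ the function $I_\alpha(r)$ is monotone nondecreasing in $r$. (ii) Let $\Phi(s)=2(\sqrt{1+s}-1)$ and let $u=(u_i)_{i=1}^m$ be a classical solution of $-\operatorname{div}\left(\frac{\nabla u_i}{\sqrt{1+|\nabla u_i|^2}}\right)=H_i(u)$ in $\mathbb{R}^n$, $i=1,\dots,m$. Then for all $\alpha\ge 2$ the function $I_\alpha(r)$ is monotone nondecreasing in $r$. (iii) Let $p>1$, $\Phi(s)=\frac2p s^{p/2}$ and let $u=(u_i)_{i=1}^m$ be a classical solution of $-\operatorname{div}\left(|\nabla u_i|^{p-2}\nabla u_i\right)=H_i(u)$ in $\mathbb{R}^n$, $i=1,\dots,m$. Then for all $\alpha\ge p$ the function $I_\alpha(r)$ is monotone nondecreasing in $r$.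
   Context: Each $H_i\in C^1(\mathbb{R}^m)$ is real valued; with $\partial_jH_i(u)=\partial H_i(u)/\partial u_j$ one assumes (standing assumption) $\partial_iH_j(u)\,\partial_jH_i(u)>0$ for $1\le i\le j\le m$. $\tilde H:\mathbb{R}^m\to\mathbb{R}$ is a function (assumed to exist) with $\partial_i\tilde H=H_i$ for all $i$. $B_r$ is the ball of radius $r$ centered at the origin in $\mathbb{R}^n$. *)

(* Defs.v *)
From HB Require Import structures.
From mathcomp Require Import all_boot all_order all_algebra.
From mathcomp Require Import all_classical all_reals all_analysis.

Set Implicit Arguments.
Unset Strict Implicit.
Unset Printing Implicit Defensive.

Import Order.TTheory GRing.Theory Num.Theory.
Import numFieldNormedType.Exports.

Local Open Scope classical_set_scope.
Local Open Scope ring_scope.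

(* The n-dimensional Lebesgue measure, on the product sigma-algebra of
   n.-tuple R: the unit mass on the point R^0, then at each step the image of
   the product measure under (t, x) |-> x :: t. *)
Section LebesgueTuple.
Context {R : realType}.
Local Open Scope ereal_scope.

Definition cons_pair n (q : n.-tuple (measurableTypeR R) * measurableTypeR R) :
  n.+1.-tuple (measurableTypeR R) := [tuple of q.2 :: q.1].

Lemma measurable_cons_pair n : measurable_fun [set: _] (@cons_pair n).
Proof. by apply: measurable_cons; [exact: measurable_snd|exact: measurable_fst]. Qed.

Section Step.
Variables (n : nat) (mu : {measure set (n.-tuple (measurableTypeR R)) -> \bar R}).

Definition lebesgue_step : set (n.+1.-tuple (measurableTypeR R)) -> \bar R :=
  pushforward (mu \x @lebesgue_measure R) (@cons_pair n).

Let pre_measurable (A : set (n.+1.-tuple (measurableTypeR R))) :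
  measurable A -> measurable (@cons_pair n @^-1` A).
Proof.
by move=> mA; rewrite -[X in measurable X]setTI; exact: measurable_cons_pair.
Qed.

Let step0 : lebesgue_step set0 = 0.
Proof. by rewrite /lebesgue_step /pushforward preimage_set0 measure0. Qed.

Let step_ge0 A : 0 <= lebesgue_step A.
Proof. by rewrite /lebesgue_step /pushforward measure_ge0. Qed.

Let step_sigma_additive : semi_sigma_additive lebesgue_step.
Proof.
move=> F mF tF mUF; rewrite /lebesgue_step /pushforward preimage_bigcup.
apply: measure_semi_sigma_additive.
- by move=> i; exact: pre_measurable.
- apply/trivIsetP => i j _ _ ij; rewrite -preimage_setI.
  by move/trivIsetP : tF => /(_ _ _ _ _ ij) ->//; rewrite preimage_set0.
- by rewrite -preimage_bigcup; exact: pre_measurable.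
Qed.

HB.instance Definition _ := isMeasure.Build _ _ _ lebesgue_step
  step0 step_ge0 step_sigma_additive.

End Step.

Fixpoint lebesgue_tuple n : {measure set (n.-tuple (measurableTypeR R)) -> \bar R} :=
  match n with
  | 0 => dirac [tuple]
  | n'.+1 => lebesgue_step (lebesgue_tuple n')
  end.

End LebesgueTuple.
Arguments lebesgue_tuple : clear implicits.

Section Calculus.
Context {R : realType} {n : nat}.
Implicit Types (f : 'rV[R]_n -> R) (x : 'rV[R]_n).

Definition partial (k : 'I_n) f x : R := 'D_(delta_mx 0 k) f x.

Definition C1 f : Prop := forall k,
  (forall x, derivable f x (delta_mx 0 k)) /\ continuous (partial k f).

Definition C2 f : Prop := C1 f /\ forall k, C1 (partial k f).

Definition grad f x : 'rV[R]_n := \row_k partial k f x.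

(* The norm `|x| that 'rV[R]_n carries is the sup norm. *)
Definition enorm x : R := Num.sqrt (\sum_k x 0 k ^+ 2).

Definition divergence (V : 'rV[R]_n -> 'rV[R]_n) x : R :=
  \sum_k partial k (fun y => V y 0 k) x.

Definition laplacian f x : R := \sum_k partial k (partial k f) x.

Definition eball (r : R) : set ('rV[R]_n) := [set x | enorm x < r].

Definition tuple_row (t : n.-tuple (measurableTypeR R)) : 'rV[R]_n :=
  \row_k tnth t k.

Definition integral_on (D : set 'rV[R]_n) f : R :=
  (\int[lebesgue_tuple R n]_(t in tuple_row @^-1` D) f (tuple_row t))%R.

End Calculus.

Section Systems.
Context {R : realType} {m n : nat}.
Implicit Types (H : 'I_m -> 'rV[R]_m -> R) (Ht : 'rV[R]_m -> R).
Implicit Types (u : 'I_m -> 'rV[R]_n -> R).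

Definition standing_assumption H : Prop :=
  (forall i, C1 (H i)) /\
  forall (i j : 'I_m) (v : 'rV[R]_m), (i <= j)%N ->
    0 < partial i (H j) v * partial j (H i) v.

Definition is_potential Ht H : Prop :=
  forall (i : 'I_m) (v : 'rV[R]_m), is_derive v (delta_mx 0 i) Ht (H i v).

Definition vec u (x : 'rV[R]_n) : 'rV[R]_m := \row_i u i x.

Definition laplace_solution H u : Prop := forall i,
  C2 (u i) /\ forall x, - laplacian (u i) x = H i (vec u x).

Definition mean_curvature_flux (f : 'rV[R]_n -> R) x : 'rV[R]_n :=
  (Num.sqrt (1 + enorm (grad f x) ^+ 2))^-1 *: grad f x.

Definition mean_curvature_solution H u : Prop := forall i,
  C2 (u i) /\
  forall x, - divergence (mean_curvature_flux (u i)) x = H i (vec u x).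

(* For p < 2 the scalar factor is a junk value where the gradient vanishes, but
   the flux is 0 there, as it should be. *)
Definition p_flux (p : R) (f : 'rV[R]_n -> R) x : 'rV[R]_n :=
  (enorm (grad f x) `^ (p - 2)) *: grad f x.

(* The p-Laplacian degenerates where the gradient vanishes: for p < 2 a C^2
   function need not have a C^1 flux, and for p > 2 a function with a C^1 flux
   need not be C^2 (e.g. |x|^(p/(p-1))). Both kinds of regularity are accepted
   as classical, provided the derivatives forming the divergence exist. *)
Definition p_laplace_solution (p : R) H u : Prop := forall i,
  [/\ C1 (u i),
      C2 (u i) \/ (forall k, C1 (fun x => p_flux p (u i) x 0 k)),
      forall (k : 'I_n) x,
        derivable (fun y => p_flux p (u i) y 0 k) x (delta_mx 0 k) &
      forall x, - divergence (p_flux p (u i)) x = H i (vec u x)].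

Definition energy (Phi : R -> R) Ht u (alpha r : R) : R :=
  (r `^ (n%:R - alpha))^-1 *
  integral_on (eball r)
    (fun x => (\sum_i Phi (enorm (grad (u i) x) ^+ 2)) - 2 * Ht (vec u x)).

End Systems.

Definition nondecreasing_on_pos {R : realType} (I : R -> R) : Prop :=
  {in `]0, +oo[ &, {homo I : r s / r <= s}}.

(* Main.v *)
Require Import Defs.
From HB Require Import structures.
From mathcomp Require Import all_boot all_order all_algebra.
From mathcomp Require Import all_classical all_reals all_analysis.
From mathcomp Require Import measurable_realfun ring lra.

Set Implicit Arguments.
Unset Strict Implicit.
Unset Printing Implicit Defensive.

Import Order.TTheory GRing.Theory Num.Theory.
Import numFieldNormedType.Exports.
Local Open Scope classical_set_scope.
Local Open Scope ring_scope.

(** In all three cases the system is the Euler-Lagrange system of an energy with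
    density [e = sum_i Phi(|grad u_i|^2) - 2 Ht(u)], and the monotonicity comes
    from its invariance under translations. Put [a = Phi'] and let
    [V_i = a(|grad u_i|^2) grad u_i] be the flux, so that [- div V_i = H_i(u)].
    The stress tensor [T_jk = sum_i 2 (V_i)_j d_k u_i - e delta_jk] satisfies
    [sum_j d_j T_jk = 2 sum_i (div V_i + H_i(u)) d_k u_i = 0]; moreover
    [sum_jk T_jk x_j x_k >= - e |x|^2], because [a >= 0], and
    [tr T <= (alpha - n) e], because [2 a(s) s <= beta Phi(s)] for some
    [beta <= alpha] and [Ht <= 0] (lemma [energy_nondecreasing]).

    Testing [div T = 0] with the field [zeta(|x|^2 / r^2) x], where [zeta] is a
    nonincreasing cutoff function, gives, with [s = |x|^2 / r^2],
    [0 <= int ((alpha - n) zeta(s) - 2 s zeta'(s)) e] (lemma [radial_test]). Up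
    to a power of [r] the right-hand side is the derivative in [r] of
    [r^(alpha - n) int zeta(|x|^2 / r^2) e], which is thus nondecreasing. When
    [zeta] tends to the indicator of the unit interval this becomes the energy
    on the ball of radius [r] ([monotonicity_of_stress_tensor]). Smooth cutoffs
    replace the integrals over spheres that appear if one differentiates the
    energy on balls directly. The only integration by parts is
    [integral_partial_eq0], the vanishing of the integral of a partial derivative
    of a compactly supported function.

    The argument needs [T] to be C1. If [u_i] is C2 this is because
    [a(|q|^2) q_j q_k] and [Phi(|q|^2)] are C1 functions of [q], even when [a]
    is singular at 0 ([C1_stress]). For the p-Laplacian [u_i] may fail to be C2
    while its flux is C1; but the gradient is [|V|^(p' - 2) V] for the conjugate
    exponent [p'], so that the same tensor is a function of the flux of the same
    form, with [p'] instead of [p] ([noether_component_flux]). In both cases the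
    formula for [div T] is checked pointwise: where the gradient vanishes, [T]
    has zero derivative and both sides are 0; elsewhere the first derivatives of
    [u_i] are differentiable and Schwarz's theorem applies
    ([div_stress_regular]). The Laplacian is the p-Laplacian for [p = 2]. *)

(** * Derivatives along lines and symmetry of second derivatives *)

Section calculus.
Context {R : realType}.

Section lines.
Context {V : normedModType R}.
Implicit Types (f : V -> R) (x v : V).

(** Restriction to a line turns directional derivatives into derivatives of
    functions of one real variable, to which the mean value theorem applies. *)
Lemma is_derive_line f x v (t d : R) :
  is_derive (t *: v + x) v f d ->
  is_derive t 1 (fun s : R => f (s *: v + x)) d.
Proof.
move=> [df <-].
have E : (fun h : R => h^-1 *: (f ((h *: 1 + t) *: v + x) - f (t *: v + x))) =
         (fun h => h^-1 *: (f (h *: v + (t *: v + x)) - f (t *: v + x))).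
  by apply/funext => h; rewrite [h *: 1]mulr1 scalerDl addrA.
by apply: DeriveDef; rewrite /derivable /derive /= E.
Qed.

Lemma is_derive_translate f x v z (d : R) :
  is_derive (z + x) v f d -> is_derive x v (fun y => f (z + y)) d.
Proof.
move=> [df <-].
have E : (fun h : R => h^-1 *: (f (z + (h *: v + x)) - f (z + x))) =
         (fun h => h^-1 *: (f (h *: v + (z + x)) - f (z + x))).
  by apply/funext => h; rewrite addrCA.
by apply: DeriveDef; rewrite /derivable /derive /= E.
Qed.

(** The intermediate point is recorded through its parameter [s]: the estimates
    below only use that it is at most as far from [x] as the end point. *)
Lemma line_MVT f x v (h : R) : (forall y, derivable f y v) ->
  exists2 s, `|s| <= `|h| & f (h *: v + x) - f x = h * 'D_v f (s *: v + x).
Proof.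
move=> df; pose g s := f (s *: v + x).
have dg (t : R) : is_derive t 1 g ('D_v f (t *: v + x)).
  by apply: is_derive_line; exact: derivableP.
have cg (A : set R) : {within A, continuous g}.
  apply: continuous_subspaceT => t; apply: differentiable_continuous.
  by apply/derivable1_diffP; case: (dg t).
have -> : f x = g 0 by rewrite /g scale0r add0r.
have [h0|h0] := leP 0 h.
  have [c] := @MVT_segment R g _ 0 h h0 (fun t _ => dg t) (cg _).
  rewrite in_itv/= subr0 => /andP[c0 ch] E; exists c; last by rewrite E mulrC.
  by rewrite !ger0_norm.
have [c] := @MVT_segment R g _ h 0 (ltW h0) (fun t _ => dg t) (cg _).
rewrite in_itv/= sub0r => /andP[c0 ch] E; exists c.
  by rewrite !ler0_norm ?lerN2// ltW.
by rewrite -opprB E mulrN opprK mulrC.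
Qed.

Lemma is_derive_of_line f x v (d : R) :
  is_derive (0 : R) 1 (fun s : R => f (s *: v + x)) d -> is_derive x v f d.
Proof.
move=> [df <-].
have E : (fun h : R => h^-1 *: (f (h *: v + x) - f x)) =
    (fun h => h^-1 *: (f ((h *: (1 : R) + 0 : R) *: v + x) - f ((0 : R) *: v + x))).
  by apply/funext => h /=; rewrite [h *: 1]mulr1 addr0 scale0r add0r.
by apply: DeriveDef; rewrite /derivable /derive /= E.
Qed.

Lemma is_derive_comp1 (a : R -> R) f x v (da df : R) :
  is_derive (f x) 1 a da -> is_derive x v f df ->
  is_derive x v (fun y => a (f y)) (da * df).
Proof.
move=> Da Df; apply: is_derive_of_line.
apply: (@is_derive1_comp _ a (fun s : R => f (s *: v + x)) 0).
  by rewrite scale0r add0r.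
by apply: is_derive_line; rewrite scale0r add0r.
Qed.

Lemma is_derive_approx f x v (c : R) :
  (forall e, 0 < e -> exists2 d, 0 < d & forall h : R, `|h| < d ->
    `|f (h *: v + x) - f x - c * h| <= e * `|h|) -> is_derive x v f c.
Proof.
move=> H.
have C : h^-1 *: (f (h *: v + x) - f x) @[h --> (0 : R)^'] --> c.
  apply/cvgrPdist_le => e e0; have [d d0 Hd] := H e e0.
  near=> h; have h0 : h != 0 by near: h; exact: nbhs_dnbhs_neq.
  have hd : `|h| < d by near: h; exact: dnbhs0_lt.
  rewrite distrC -(ler_pM2r (_ : 0 < `|h|)) ?normr_gt0// -normrM.
  rewrite [_ *: _]/(_ * _) mulrBl mulrAC mulVf// mul1r; exact: Hd.
have D : derivable f x v by apply/cvg_ex; exists c.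
by apply: DeriveDef => //; exact: cvg_lim C.
Unshelve. all: by end_near. Qed.

(** The expansion to first order in epsilon-delta form, for estimates that use it
    at several increments at once. *)
Lemma diff_approx f x (e : R) : differentiable f x -> 0 < e ->
  exists2 d, 0 < d & forall h, `|h| < d ->
    `|f (h + x) - f x - 'd f x h| <= e * `|h|.
Proof.
move=> /diff_locallyP[_ /eqaddoP H] e0.
have := H; move=> /(_ e e0)/= /nbhs_normP[d /= d0 Hd]; exists d => // h hd.
have := Hd h; rewrite /ball_ /= sub0r normrN => /(_ hd).
by rewrite !fctE opprD addrA.
Qed.

Lemma differentiable_approx f x (L : {linear V -> R}) : continuous L ->
  (forall e, 0 < e -> exists2 d, 0 < d & forall h, `|h| < d ->
    `|f (h + x) - f x - L h| <= e * `|h|) ->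
  differentiable f x /\ 'd f x = L :> (V -> R).
Proof.
move=> cL H.
have E : f \o shift x = cst (f x) + L +o_ 0 id.
  apply/eqaddoP => e e0; have [d d0 Hd] := H e e0.
  apply/nbhs_normP; exists d => //= h; rewrite /ball_ /= sub0r normrN => hd.
  by have := Hd h hd; rewrite !fctE opprD addrA.
have D := diff_unique cL E.
by split => //; apply/diff_locallyP; rewrite D.
Qed.

End lines.

Section schwarz.
Context {V : normedModType R}.
Implicit Types (f : V -> R) (x v w : V).

(** Up to [o(t^2)] this is [t^2] times either mixed derivative: it is symmetric in
    [v] and [w], so the two orders of derivation agree. *)
Let second_difference f x v w (t : R) :=
  f (t *: v + (t *: w + x)) - f (t *: w + x) - (f (t *: v + x) - f x).

Let second_difference_bound f x v w (e : R) :
  (forall y, derivable f y v) -> differentiable ('D_v f) x -> 0 < e ->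
  exists2 d, 0 < d & forall t, 0 < t < d ->
   `|second_difference f x v w t - t ^+ 2 * 'D_w ('D_v f) x| <= e * t ^+ 2.
Proof.
move=> df dg e0; pose K : R := 2 * (`|v| + `|w| + 1).
have K0 : 0 < K by rewrite mulr_gt0// ltr_wpDl// addr_ge0.
(* [K] bounds twice the length, per unit of [t], of the increments used below *)
have [d d0 Hd] := diff_approx dg (divr_gt0 e0 K0).
exists (d / K) => [|t /andP[t0 td]]; first exact: divr_gt0.
pose F y := f (t *: w + y) - f y.
have dF y : is_derive y v F ('D_v f (t *: w + y) - 'D_v f y).
  apply: is_deriveB; first by apply: is_derive_translate; exact: derivableP.
  exact: derivableP.
(* the second difference is an increment of [F] along [v] *)
have [s hs E] := @line_MVT _ F x v t (fun y => @ex_derive _ _ _ _ _ _ _ (dF y)).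
have -> : second_difference f x v w t = F (t *: v + x) - F x.
  by rewrite /F/second_difference addrCA opprB !addrA; ring.
have [_ DF] := dF (s *: v + x); rewrite E DF.
have t0' : `|t| = t by rewrite gtr0_norm.
have tK : t * K < d by rewrite -ltr_pdivlMr.
have b1 : `|s *: v| <= t * `|v| by rewrite normrZ ler_wpM2r// -t0'.
have b2 : `|t *: w + s *: v| <= t * (`|v| + `|w|).
  by rewrite (le_trans (ler_normD _ _))// normrZ t0' mulrDr addrC lerD.
have vw : t * (`|v| + `|w|) <= t * K / 2.
  by rewrite /K -mulrA ler_pM2l//; lra.
have c1 : `|s *: v| <= t * K / 2.
  apply: le_trans b1 (le_trans _ vw); by rewrite ler_pM2l// lerDl.
have c2 := le_trans b2 vw.
have hK : t * K / 2 < d by have := mulr_gt0 t0 K0; lra.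
have H1 := Hd _ (le_lt_trans c1 hK).
have H2 := Hd _ (le_lt_trans c2 hK).
rewrite (addrA (t *: w)).
rewrite expr2 -mulrA -mulrBr normrM t0' [leRHS]mulrCA ler_pM2l//.
rewrite (deriveE w dg).
move: H1 H2; rewrite linearD [X in _ - (X + _)]linearZ /=.
rewrite [t *: 'd _ _ _]/(t * _).
set A := 'D_v f (_ + x); set B := 'D_v f (_ + _); set C := 'D_v f x.
set D := 'd _ _ _; set D' := 'd _ _ _ => H1 H2.
have eK : e / K * (t * K / 2) = e * t / 2.
  by rewrite mulrA mulrACA -mulrA; field; lra.
have e' : 0 <= e / K by rewrite divr_ge0// ltW.
have I1 : `|A - C - D'| <= e * t / 2.
  by rewrite -eK (le_trans H1)// ler_wpM2l.
have I2 : `|B - C - (t * D + D')| <= e * t / 2.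
  by rewrite -eK (le_trans H2)// ler_wpM2l.
have -> : B - A - t * D = (B - C - (t * D + D')) - (A - C - D') by ring.
by rewrite (le_trans (ler_normB _ _))//; lra.
Qed.

(** Second-order information enters only at the point itself, as differentiability
    of both first derivatives: for a flux of class C1 this is what composition with
    differentiable functions provides. *)
Lemma schwarz f x v w :
  (forall y, derivable f y v) -> (forall y, derivable f y w) ->
  differentiable ('D_v f) x -> differentiable ('D_w f) x ->
  'D_w ('D_v f) x = 'D_v ('D_w f) x.
Proof.
move=> dv dw Dv Dw; apply/eqP; rewrite -subr_eq0 -normr_le0.
apply/ler_addgt0Pr => e e0; rewrite add0r.
have e2 : 0 < e / 2 by rewrite divr_gt0.
have [d1 d10 H1] := second_difference_bound w dv Dv e2.
have [d2 d20 H2] := second_difference_bound v dw Dw e2.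
pose t := Num.min d1 d2 / 2.
have m0 : 0 < Num.min d1 d2 by rewrite lt_min d10.
have t0 : 0 < t by rewrite divr_gt0.
have tm : t < Num.min d1 d2 by rewrite /t; lra.
have {H1} := H1 t; rewrite t0 (lt_le_trans tm) ?ge_min ?lexx// => /(_ isT) H1.
have {H2} := H2 t; rewrite t0 (lt_le_trans tm) ?ge_min ?lexx ?orbT// => /(_ isT).
have -> : second_difference f x w v t = second_difference f x v w t.
  rewrite /second_difference [t *: w + (_ + _)]addrCA; ring.
set D := second_difference _ _ _ _ _ in H1 *.
set P := 'D_w _ _ in H1 *; set Q := 'D_v _ _ => H2.
have t20 : 0 < t ^+ 2 by rewrite exprn_gt0.
rewrite -(ler_pM2l t20) -[X in X * `|_|]gtr0_norm// -normrM.
have -> : t ^+ 2 * (P - Q) = (D - t ^+ 2 * Q) - (D - t ^+ 2 * P) by ring.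
rewrite (le_trans (ler_normB _ _))// (le_trans (lerD H2 H1))//.
by rewrite -mulrDl -splitr mulrC.
Qed.

End schwarz.
End calculus.

(** * Functions of class C1 *)

Section rows.
Context {R : realType}.

Lemma continuous_sumr (T : topologicalType) (I : finType) (F : I -> T -> R) (x : T) :
  (forall i, {for x, continuous (F i)}) ->
  {for x, continuous (fun y => \sum_i F i y)}.
Proof.
by move=> cF; apply: cvg_big => [|i _]; [exact: add_continuous|exact: cF].
Qed.

Lemma coord_le_norm n (x : 'rV[R]_n) k : `|x 0 k| <= `|x|.
Proof. by rewrite [leRHS]/Num.Def.normr/= mx_normrE; exact: (le_bigmax _ _ (0, k)). Qed.

Lemma norm_le_coord n (x : 'rV[R]_n) (e : R) : 0 <= e ->
  (forall k, `|x 0 k| <= e) -> `|x| <= e.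
Proof.
move=> e0 H; rewrite [leLHS]/Num.Def.normr/= mx_normrE (bigmax_le _ e0)//= => -[i k] _.
by rewrite /= (ord1 i).
Qed.

Lemma continuous_vec m n (u : 'I_m -> 'rV[R]_n -> R) (x : 'rV[R]_n) :
  (forall i, {for x, continuous (u i)}) -> {for x, continuous (vec u)}.
Proof.
move=> cu; pose F : set_system 'rV[R]_n := nbhs x.
have FF : Filter F by exact: nbhs_filter.
suff : vec u @ F --> vec u x by [].
apply/cvgrPdist_le => e e0.
have H : \forall y \near F, forall i : 'I_m, `|u i x - u i y| <= e.
  apply: filter_forall => i; exact: (proj1 (cvgrPdist_le _ _) (cu i) e e0).
near=> y; apply: norm_le_coord; first exact: ltW.
by move=> i; rewrite !mxE; move: i; near: y; exact: H.
Unshelve. all: by end_near. Qed.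

Section C1.
Context {n : nat}.
Implicit Types f g : 'rV[R]_n -> R.

(** The increment is split into steps along the axes; by the mean value theorem
    each of them is a coordinate increment times a partial derivative at a nearby
    point, and continuity moves that point to [x]. *)
Lemma C1_differentiable f x : C1 f -> differentiable f x.
Proof.
move=> Cf.
pose L (h : 'rV[R]_n) : R^o := \sum_k h 0 k * partial k f x.
have L_lin : linear L.
  move=> c h h'; rewrite /L scaler_sumr -big_split/=; apply: eq_bigr => k _.
  by rewrite !mxE mulrDl /GRing.scale/= mulrA.
pose LM := GRing.isLinear.Build _ _ _ _ L L_lin.
pose LL : {linear 'rV[R]_n -> R^o} := HB.pack L LM.
have cL : continuous LL.
  move=> h; apply: continuous_sumr => k.
  apply: continuousM; last exact: cst_continuous.
  exact: coord_continuous.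
suff H : forall e, 0 < e -> exists2 d, 0 < d & forall h, `|h| < d ->
    `|f (h + x) - f x - LL h| <= e * `|h|.
  by have [] := differentiable_approx cL H.
move=> e e0; pose e' := e / n.+1%:R.
have e'0 : 0 < e' by rewrite divr_gt0.
pose F : set_system 'rV[R]_n := nbhs x.
have FF : Filter F by exact: nbhs_filter.
have : \forall y \near F, forall k : 'I_n, `|partial k f x - partial k f y| <= e'.
  apply: filter_forall => k; have [_ ck] := Cf k.
  exact: (proj1 (cvgrPdist_le _ _) (ck x) e' e'0).
move=> /nbhs_normP[d /= d0 Hd]; exists d => // h hd.
(* the corners of the path from [x] to [h + x] that follows the axes *)
pose y j : 'rV[R]_n := \row_k (if (k < j)%N then (h + x) 0 k else x 0 k).
have yn : y n = h + x by apply/rowP => k; rewrite mxE ltn_ord.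
have y0 : y 0%N = x by apply/rowP => k; rewrite mxE.
have yS (j : 'I_n) : y j.+1 = h 0 j *: delta_mx 0 j + y j.
  apply/rowP => k; rewrite !mxE/= ltnS leq_eqVlt -val_eqE/=.
  by case: ltngtP => [kj|kj|/val_inj ->]/=; rewrite ?mulr0 ?add0r ?mulr1.
have -> : f (h + x) - f x = \sum_(j < n) (f (y j.+1) - f (y j)).
  by rewrite -yn -[in f x]y0 -(telescope_sumr (fun j => f (y j)))// big_mkord.
rewrite /= /L -sumrB (le_trans (ler_norm_sum _ _ _))//.
apply: (@le_trans _ _ (\sum_(j < n) `|h| * e')); last first.
  rewrite sumr_const card_ord -mulr_natr -mulrA mulrC ler_wpM2r//.
  by rewrite /e' -mulrA ler_piMr ?ltW// ltr_pdivrMl// mulr1 ltr_nat.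
apply: ler_sum => j _; rewrite yS.
have [dj _] := Cf j.
have [s hs ->] := line_MVT (y j) (h 0 j) dj.
rewrite -mulrBr normrM ler_pM// ?coord_le_norm// distrC.
apply: Hd => /=; apply: le_lt_trans hd.
apply: norm_le_coord => // k; rewrite !mxE/= -val_eqE/=.
have sh := le_trans hs (coord_le_norm h j).
case: ltngtP => [kj|kj|/val_inj ->]/=.
- by rewrite mulr0 add0r opprD addrCA subrr addr0 normrN coord_le_norm.
- by rewrite mulr0 add0r subrr normr0.
- by rewrite mulr1 opprD addrCA subrr addr0 normrN.
Qed.

Lemma C1_continuous f : C1 f -> continuous f.
Proof. by move=> Cf x; apply: differentiable_continuous; exact: C1_differentiable. Qed.

Lemma C1_is_derive f k x : C1 f -> is_derive x (delta_mx 0 k) f (partial k f x).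
Proof. by move=> Cf; apply: derivableP; case: (Cf k). Qed.

Lemma C1_intro f (df : 'I_n -> 'rV[R]_n -> R) :
  (forall k x, is_derive x (delta_mx 0 k) f (df k x)) ->
  (forall k, continuous (df k)) -> C1 f.
Proof.
move=> Df cf k; split=> [x|]; first by have [] := Df k x.
rewrite (_ : partial k f = df k)//.
by apply/funext => x; have [_ <-] := Df k x.
Qed.

Lemma differentiable_partial f x (v : 'rV[R]_n) : differentiable f x ->
  'd f x v = \sum_k v 0 k * partial k f x.
Proof.
move=> Df; rewrite {1}[v]row_sum_delta linear_sum; apply: eq_bigr => k _.
by rewrite linearZ/= -deriveE.
Qed.

End C1.

(** The inner functions need only be derivable along [v]: the rule is applied to
    the curve [s |-> vec w (s v + x)], which is differentiable at 0. *)
Lemma is_derive_chain m n (G : 'rV[R]_m -> R) (w : 'I_m -> 'rV[R]_n -> R)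
    (x v : 'rV[R]_n) (dw : 'I_m -> R) :
  differentiable G (vec w x) -> (forall i, is_derive x v (w i) (dw i)) ->
  is_derive x v (fun y => G (vec w y)) (\sum_i partial i G (vec w x) * dw i).
Proof.
move=> DG Dw; apply: is_derive_of_line.
pose c (s : R) : 'rV[R]_m := vec w (s *: v + x).
have c0 : c 0 = vec w x by rewrite /c scale0r add0r.
have Dci i : is_derive (0 : R) 1 (fun s => c s 0 i) (dw i).
  have -> : (fun s => c s 0 i) = (fun s => w i (s *: v + x)).
    by apply/funext => s; rewrite mxE.
  by apply: is_derive_line; rewrite scale0r add0r.
have Dc : derivable c 0 1.
  by apply/derivable_mxP => i j; rewrite (ord1 i); case: (Dci j).
have Dcd : differentiable c 0 by apply/derivable1_diffP.
have DG' : differentiable G (c 0) by rewrite c0.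
have DGc : differentiable (G \o c) 0 by exact: differentiable_comp.
apply: DeriveDef; first by apply/derivable1_diffP.
rewrite deriveE// (diff_comp Dcd DG') c0.
rewrite -[LHS]/('d G (vec w x) ('d c 0 1)) differentiable_partial//.
apply: eq_bigr => i _; rewrite mulrC; congr (_ * _).
rewrite -deriveE// derive_mx// mxE.
by have [_ ->] := Dci i.
Qed.

Lemma C1_comp m n (G : 'rV[R]_m -> R) (w : 'I_m -> 'rV[R]_n -> R) :
  C1 G -> (forall i, C1 (w i)) -> C1 (fun y => G (vec w y)).
Proof.
move=> CG Cw.
apply: (@C1_intro _ _ (fun k x => \sum_i partial i G (vec w x) * partial k (w i) x)).
  move=> k x; apply: is_derive_chain; first exact: C1_differentiable.
  by move=> i; exact: C1_is_derive.
move=> k x; apply: continuous_sumr => i.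
apply: (@continuousM _ _ (partial i G \o vec w)); last by have [_] := Cw i k; exact.
apply: continuous_comp; first by apply: continuous_vec => j; exact: C1_continuous.
by have [_] := CG i; exact.
Qed.

End rows.

Section squared_norm.
Context {R : realType} {n : nat}.
Implicit Types x q : 'rV[R]_n.

(** The square of the Euclidean norm, smooth at 0 unlike the norm itself; row
    vectors carry the sup norm. *)
Definition sqnorm x : R := \sum_k x 0 k ^+ 2.

Lemma sqnorm_ge0 x : 0 <= sqnorm x.
Proof. by apply: sumr_ge0 => k _; exact: sqr_ge0. Qed.

Lemma coord_sqr_le_sqnorm x k : x 0 k ^+ 2 <= sqnorm x.
Proof.
by rewrite /sqnorm (bigD1 k)//= lerDl sumr_ge0// => j _; exact: sqr_ge0.
Qed.

Lemma sqnorm_eq0 x : sqnorm x = 0 -> x = 0.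
Proof.
move=> H; apply/rowP => k; rewrite mxE; apply/eqP.
by rewrite -sqrf_eq0 eq_le sqr_ge0 -H coord_sqr_le_sqnorm.
Qed.

Lemma sqnorm0 : sqnorm (0 : 'rV[R]_n) = 0.
Proof. by rewrite /sqnorm big1// => k _; rewrite mxE expr0n. Qed.

Lemma sqnorm_gt0 q : q != 0 -> 0 < sqnorm q.
Proof.
by move=> q0; rewrite lt_def sqnorm_ge0 andbT; apply: contra q0 => /eqP/sqnorm_eq0/eqP.
Qed.

Lemma coord_le_sqrt_sqnorm q k : `|q 0 k| <= Num.sqrt (sqnorm q).
Proof. by rewrite -sqrtr_sqr ler_wsqrtr// coord_sqr_le_sqnorm. Qed.

(** Outside a large enough sup-norm ball the squared Euclidean norm exceeds [S];
    the radius [S + 1] spares a square root. *)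
Lemma sqnorm_gt (S : R) x : 0 <= S -> S + 1 < `|x| -> S < sqnorm x.
Proof.
move=> S0; apply: contraTT; rewrite -!leNgt => H; apply: norm_le_coord => [|k].
  by rewrite addr_ge0.
have := le_trans (coord_sqr_le_sqnorm x k) H.
rewrite -real_normK ?num_real//; have := normr_ge0 (x 0 k); nra.
Qed.

Lemma is_derive_coord x k j :
  is_derive x (delta_mx 0 j) (fun y : 'rV[R]_n => y 0 k) (k == j)%:R.
Proof.
apply: is_derive_approx => e e0; exists 1 => // h _.
rewrite !mxE eqxx/= addrK mulrC subrr normr0 mulr_ge0//; exact: ltW.
Qed.

Lemma is_derive_sqnorm x j : is_derive x (delta_mx 0 j) sqnorm (2 * x 0 j).
Proof.
have -> : sqnorm = \sum_k (fun y : 'rV[R]_n => y 0 k * y 0 k).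
  by apply/funext => y; rewrite fct_sumE.
apply: is_derive_eq.
  apply: is_derive_sum => k; apply: is_deriveM; exact: is_derive_coord.
rewrite (bigD1 j)//= big1 => [|k kj]; first by rewrite eqxx /GRing.scale/=; ring.
by rewrite (negbTE kj) /GRing.scale/= !mulr0 addr0.
Qed.

Lemma C1_sqnorm : C1 sqnorm.
Proof.
apply: (C1_intro (df := fun k x => 2 * x 0 k)) => [k x|k x].
  exact: is_derive_sqnorm.
apply: (@continuousM _ _ (cst 2) (fun y : 'rV[R]_n => y 0 k)).
  exact: cst_continuous.
exact: coord_continuous.
Qed.

Lemma eballE (r : R) : 0 < r -> eball r = [set x | sqnorm x < r ^+ 2].
Proof.
move=> r0; apply/seteqP; split => x; rewrite /eball /= /enorm -/(sqnorm x) => H.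
  by rewrite -(sqr_sqrtr (sqnorm_ge0 x)) ltr_pXn2r ?nnegrE ?sqrtr_ge0// ltW.
by rewrite -(gtr0_norm r0) -sqrtr_sqr ltr_sqrt// exprn_gt0.
Qed.

End squared_norm.

Section C1_algebra.
Context {R : realType} {n : nat}.
Implicit Types f g : 'rV[R]_n -> R.

Lemma continuous_mul (U : topologicalType) (f g : U -> R) : continuous f -> continuous g ->
  continuous (fun x => f x * g x).
Proof. by move=> cf cg x; exact: (continuousM (cf x) (cg x)). Qed.

Lemma continuous_add (U : topologicalType) (f g : U -> R) : continuous f -> continuous g ->
  continuous (fun x => f x + g x).
Proof. by move=> cf cg x; exact: (continuousD (cf x) (cg x)). Qed.

Lemma continuous_sub (U : topologicalType) (f g : U -> R) : continuous f -> continuous g ->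
  continuous (fun x => f x - g x).
Proof. by move=> cf cg x; exact: (continuousB (cf x) (cg x)). Qed.

Lemma C1_partial_continuous f k : C1 f -> continuous (partial k f).
Proof. by move=> Cf; case: (Cf k). Qed.

Lemma C1D f g : C1 f -> C1 g -> C1 (fun x => f x + g x).
Proof.
move=> Cf Cg; apply: (C1_intro (df := fun k x => partial k f x + partial k g x)).
  by move=> k x; apply: is_deriveD; exact: C1_is_derive.
by move=> k; apply: continuous_add; exact: C1_partial_continuous.
Qed.

Lemma C1M f g : C1 f -> C1 g -> C1 (fun x => f x * g x).
Proof.
move=> Cf Cg; apply: (C1_intro
  (df := fun k x => f x * partial k g x + g x * partial k f x)).
  by move=> k x; apply: is_deriveM; exact: C1_is_derive.
move=> k; apply: continuous_add; apply: continuous_mul;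
  solve [exact: C1_partial_continuous|exact: C1_continuous].
Qed.

Lemma C1_cst (c : R) : C1 (fun _ : 'rV[R]_n => c).
Proof.
apply: (C1_intro (df := fun _ _ => 0)) => k x.
exact: cst_continuous.
Qed.

Lemma C1_sum (I : finType) (F : I -> 'rV[R]_n -> R) :
  (forall i, C1 (F i)) -> C1 (fun x => \sum_i F i x).
Proof.
move=> CF; rewrite (_ : (fun x => _) = \sum_i F i); last first.
  by apply/funext => x; rewrite fct_sumE.
by apply: big_ind => [|f g|i _]; [exact: C1_cst|exact: C1D|exact: CF].
Qed.

Lemma C1_coord j : C1 (fun x : 'rV[R]_n => x 0 j).
Proof.
apply: (C1_intro (df := fun k _ => (j == k)%:R)) => [k x|k x].
  exact: is_derive_coord.
exact: cst_continuous.
Qed.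

Lemma C1_comp1 (w dw : R -> R) f : (forall s : R, is_derive s 1 w (dw s)) ->
  continuous dw -> C1 f -> C1 (fun x => w (f x)).
Proof.
move=> Dw cdw Cf; apply: (C1_intro (df := fun k x => dw (f x) * partial k f x)).
  by move=> k x; apply: is_derive_comp1; exact: C1_is_derive.
move=> k; apply: continuous_mul; last exact: C1_partial_continuous.
move=> x; apply: (@continuous_comp _ _ _ f dw); last exact: cdw.
exact: C1_continuous.
Qed.

End C1_algebra.

(** * Integration in R^n *)

Definition cube {R : realType} n (M : R) : set (n.-tuple (measurableTypeR R)) :=
  [set t | forall k, `|tnth t k| <= M].
Arguments cube {R} n M _.

Section lebesgue_tuple.
Context {R : realType}.
Local Notation tup n := (n.-tuple (measurableTypeR R)).

(** Tuples carry the product sigma-algebra, and an open set is the union of the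
    countably many rational boxes that it contains. *)
Lemma measurable_open_row n (U : set 'rV[R]_n) : open U ->
  measurable (@tuple_row R n @^-1` U).
Proof.
move=> oU.
pose box (q : {ffun 'I_n -> rat} * rat) : set 'rV[R]_n :=
  [set x | forall k, `|x 0 k - ratr (q.1 k)| < ratr q.2].
pose piece q : set (tup n) :=
  if asbool (box q `<=` U) then @tuple_row R n @^-1` (box q) else set0.
have -> : @tuple_row R n @^-1` U = \bigcup_q piece q.
  apply/seteqP; split=> [t /= Ut|t [q _]]; last first.
    by rewrite /piece; case: asboolP => // qU; exact: qU.
  have /nbhs_normP[e /= e0 He] : nbhs (tuple_row t) U by exact: open_nbhs_nbhs.
  have e20 : 0 < e / 2 by rewrite divr_gt0.
  have [r] := rat_in_itvoo e20.
  rewrite in_itv/= => /andP[r0 re].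
  have /choice[q Hq] : forall k : 'I_n, exists q : rat,
      `|tuple_row t 0 k - ratr q| < ratr r.
    move=> k; set a := tuple_row t 0 k.
    have [|q] := @rat_in_itvoo R (a - ratr r) (a + ratr r).
      by rewrite ltrBlDr -addrA ltrDl addr_gt0.
    rewrite in_itv/= => /andP[aq qa]; exists q.
    by rewrite ltr_norml; lra.
  exists ([ffun k => q k], r) => //.
  rewrite /piece; case: asboolP => [_ k /=|]; first by rewrite ffunE.
  case => y Hy; apply: He => /=.
  apply: le_lt_trans (_ : ratr r + ratr r < e); last by lra.
  apply: norm_le_coord; first by rewrite addr_ge0// ltW.
  move=> k; have := Hy k; have := Hq k; rewrite /= ffunE !mxE => h1 h2.
  by move: h1 h2; rewrite !ltr_norml ler_norml; lra.
apply: countable_bigcupT_measurable => [|q]; first exact: countableP.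
rewrite /piece; case: ifP => // _.
have -> : @tuple_row R n @^-1` (box q) = \bigcap_(k in [set: 'I_n])
   ((fun t : tup n => tnth t k) @^-1` [set x : R | `|x - ratr (q.1 k)| < ratr q.2]).
  apply/seteqP; split=> t /=.
    by move=> H k _ /=; have := H k; rewrite mxE.
  by move=> H k; rewrite mxE; exact: H.
apply: fin_bigcap_measurable => // k _.
rewrite -[X in measurable X]setTI; apply: measurable_tnth => //.
apply: open_measurable.
rewrite (_ : [set x | _] = ball (ratr (q.1 k) : R) (ratr q.2)).
  exact: ball_open.
by apply/seteqP; split => x; rewrite -ball_normE/= distrC.
Qed.

Lemma measurable_fun_row n (f : 'rV[R]_n -> R) : continuous f ->
  measurable_fun [set: tup n] (fun t => f (tuple_row t)).
Proof.
move=> cf; apply: (measurability _ (RGenOInfty.measurableE R)) => //.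
move=> /= _ [_ [a ->] <-]; rewrite setTI.
apply: (@measurable_open_row n (f @^-1` `]a, +oo[)).
by apply: open_comp => //; exact: interval_open.
Qed.

Lemma measurable_cube n (M : R) : measurable (cube n M).
Proof.
have -> : cube n M = \bigcap_(k in [set: 'I_n])
    ((fun t : tup n => tnth t k) @^-1` `[- M, M]%classic).
  apply/seteqP; split=> t /= H k; first by move=> _; rewrite /= in_itv/= -ler_norml.
  by have := H k I; rewrite /= in_itv/= -ler_norml.
apply: fin_bigcap_measurable => // k _.
rewrite -[X in measurable X]setTI; exact: measurable_tnth.
Qed.

Lemma lebesgue_cube_lty n (M : R) : (lebesgue_tuple R n (cube n M) < +oo)%E.
Proof.
elim: n => [|n IH].
  by rewrite /= /dirac indicE; case: (_ \in _); rewrite ltry.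
rewrite /= /lebesgue_step /pushforward.
have -> : @cons_pair R n @^-1` (cube n.+1 M) = cube n M `*` `[- M, M]%classic.
  apply/seteqP; split=> -[t x] /=.
    move=> H; split=> [k|]; last by have := H ord0; rewrite /= in_itv/= -ler_norml.
    by have := H (lift ord0 k); rewrite tnthS.
  move=> [H1 /=]; rewrite in_itv/= -ler_norml => H2 k.
  by case: (unliftP ord0 k) => [j ->|-> //]; rewrite tnthS; exact: H1.
rewrite product_measure1E//; last exact: measurable_cube.
apply: lte_mul_pinfty; rewrite ?measure_ge0//.
  by rewrite ge0_fin_numE ?measure_ge0.
by rewrite [ltLHS]lebesgue_measure_itv/=; case: ifPn; rewrite ltry.
Qed.

Lemma sigma_finite_lebesgue_tuple n : sigma_finite setT (lebesgue_tuple R n).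
Proof.
exists (fun k => cube n (k%:R : R)) => [|k]; last first.
  by split; [exact: measurable_cube|exact: lebesgue_cube_lty].
apply/seteqP; split=> // t _.
exists (Num.truncn (`|tuple_row t|)).+1 => // k.
have := coord_le_norm (tuple_row t) k; rewrite mxE => /le_trans; apply.
by rewrite ltW// truncnS_gt.
Qed.

End lebesgue_tuple.

(** A copy of the measure that carries the sigma-finiteness required by Fubini's
    theorem. *)
Definition lebesgue_sf {R : realType} n :
  set (n.-tuple (measurableTypeR R)) -> \bar R := lebesgue_tuple R n.
Arguments lebesgue_sf R n _ : clear implicits.

HB.instance Definition _ (R : realType) n :=
  Measure.copy (lebesgue_sf R n) (lebesgue_tuple R n).
HB.instance Definition _ (R : realType) n :=
  @isSFinite.Build _ _ _ (lebesgue_sf R n)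
    (sfinite_measure_sigma_finite (sigma_finite_lebesgue_tuple n)).
HB.instance Definition _ (R : realType) n :=
  @isSigmaFinite.Build _ _ _ (lebesgue_sf R n) (sigma_finite_lebesgue_tuple n).

Section integration.
Context {R : realType}.
Local Notation tup n := (n.-tuple (measurableTypeR R)).

Lemma continuous_bounded_on_ball n (f : 'rV[R]_n -> R) (M : R) : continuous f ->
  exists C, forall x, `|x| <= M -> `|f x| <= C.
Proof.
move=> cf; have [M0|M0] := ltP M 0.
  by exists 0 => x xM; have := normr_ge0 x; lra.
pose A := [set x : 'rV[R]_n | `|x| <= M].
have cA : compact A.
  apply: bounded_closed_compact.
    by exists M; split; [exact: num_real|move=> y My x /= xM; exact: le_trans (ltW My)].
  apply: (@preimage_closed _ _ (fun x : 'rV[R]_n => `|x|) [set y | y <= M]).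
    by move=> x _; exact: norm_continuous.
  exact: closed_le.
have A0 : A !=set0 by exists 0; rewrite /A/= normr0.
have cnf : {within A, continuous (fun x => `|f x|)}.
  apply: continuous_subspaceT => x.
  by apply: (@continuous_comp _ _ _ f (@Num.norm _ _)); [exact: cf|exact: norm_continuous].
have [c cA' Hc] := EVT_max_rV A0 cA cnf.
by exists `|f c| => x xM; apply: Hc; rewrite inE.
Qed.

Lemma integrable_compact_support n (f : 'rV[R]_n -> R) (M C : R) : 0 <= M ->
  measurable_fun [set: tup n] (fun t => f (tuple_row t)) ->
  (forall x, `|x| <= M -> `|f x| <= C) -> (forall x, M < `|x| -> f x = 0) ->
  (lebesgue_tuple R n).-integrable setT (EFin \o (fun t => f (tuple_row t))).
Proof.
move=> M0 mf fC f0.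
pose g (t : tup n) := f (tuple_row t).
have E : EFin \o g = (EFin \o g) \_ (cube n M).
  apply/funext => t; rewrite patchE; case: ifPn => // /negP tM.
  rewrite /g /= f0// ltNge; apply/negP => H; apply: tM; rewrite inE => k.
  by have := coord_le_norm (tuple_row t) k; rewrite mxE => /le_trans; apply.
rewrite -/g E; apply/integrable_restrict => //; first exact: measurable_cube.
rewrite setTI; apply: measurable_bounded_integrable.
- exact: measurable_cube.
- exact: lebesgue_cube_lty.
- exact: measurable_funS mf.
- exists C; split; first exact: num_real.
  move=> y Cy t tM; apply: le_trans (ltW Cy); rewrite /g.
  by apply: fC; apply: norm_le_coord => // k; rewrite mxE; exact: tM.
Qed.

Lemma integrable_continuous_compact_support n (f : 'rV[R]_n -> R) (M : R) :
  continuous f -> (forall x, M < `|x| -> f x = 0) ->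
  (lebesgue_tuple R n).-integrable setT (EFin \o (fun t => f (tuple_row t))).
Proof.
move=> cf f0; have [C HC] := continuous_bounded_on_ball `|M| cf.
apply: (@integrable_compact_support _ f `|M| C) => //.
  exact: measurable_fun_row.
by move=> x xM; apply: f0; exact: le_lt_trans (ler_norm M) xM.
Qed.

Lemma integral_derive_eq0 (g g' : R -> R) (M : R) :
  (forall x : R, is_derive x 1 g (g' x)) -> continuous g' ->
  (forall x, M < `|x| -> g x = 0 /\ g' x = 0) ->
  (\int[lebesgue_measure]_x (g' x)%:E = 0)%E.
Proof.
move=> Dg cg' g0; pose N := `|M| + 1.
have MN : M < N by rewrite /N (le_lt_trans (ler_norm M))// ltrDl.
have N0 : 0 < N by rewrite ltr_wpDl.
have E : (fun x => (g' x)%:E) = (fun x => (g' x)%:E) \_ `[- N, N].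
  apply/funext => x; rewrite patchE; case: ifPn => // /negP xN.
  suff /g0[_ ->] : M < `|x| by [].
  rewrite ltNge; apply/negP => xM; apply: xN; rewrite inE/= in_itv/= -ler_norml.
  exact: le_trans xM (ltW MN).
rewrite E -integral_mkcond (@continuous_FTC2 _ g' g).
- have [gN _] : g N = 0 /\ g' N = 0 by apply: g0; rewrite gtr0_norm.
  have [gN' _] : g (- N) = 0 /\ g' (- N) = 0.
    by apply: g0; rewrite normrN gtr0_norm.
  by rewrite gN gN' sube0.
- by rewrite gtrN.
- exact: continuous_subspaceT.
- have cg : continuous g.
    move=> x; apply: differentiable_continuous; apply/derivable1_diffP.
    by case: (Dg x).
  split.
  + by move=> x _; case: (Dg x).
  + by apply: cvg_at_right_filter; exact: cg.
  + by apply: cvg_at_left_filter; exact: cg.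
- by move=> x _; rewrite derive1E; case: (Dg x).
Qed.

(** Prepending a coordinate, as in the recursive definition of the measure. *)
Definition consr n (x : R) (y : 'rV[R]_n) : 'rV[R]_n.+1 :=
  \row_k (if unlift ord0 k is Some j then y 0 j else x).

Lemma consr0 n x (y : 'rV[R]_n) : consr x y 0 ord0 = x.
Proof. by rewrite mxE unlift_none. Qed.

Lemma consrS n x (y : 'rV[R]_n) j : consr x y 0 (lift ord0 j) = y 0 j.
Proof. by rewrite mxE liftK. Qed.

Lemma tuple_row_cons_pair n (t : tup n) (x : R) :
  tuple_row (cons_pair (t, x)) = consr x (tuple_row t).
Proof.
apply/rowP => k; rewrite mxE; case: (unliftP ord0 k) => [j ->|->].
  by rewrite consrS mxE tnthS.
by rewrite consr0.
Qed.

Lemma consr_head n (h x : R) (y : 'rV[R]_n) :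
  consr (h + x) y = h *: delta_mx 0 ord0 + consr x y.
Proof.
apply/rowP => k; rewrite !mxE eqxx/=.
have [j ->|->] := unliftP ord0 k; last by rewrite eqxx mulr1.
by rewrite eq_sym (negbTE (neq_lift _ _)) mulr0 add0r.
Qed.

Lemma consr_tail n (h x : R) (y : 'rV[R]_n) j :
  consr x (h *: delta_mx 0 j + y) = h *: delta_mx 0 (lift ord0 j) + consr x y.
Proof.
apply/rowP => k; rewrite !mxE eqxx/=.
have [i ->|->] := unliftP ord0 k.
  by rewrite !mxE eqxx/= (inj_eq (@lift_inj _ ord0)).
by rewrite (negbTE (neq_lift _ _)) mulr0 add0r.
Qed.

Lemma consr_norml n (x : R) (y : 'rV[R]_n) : `|x| <= `|consr x y|.
Proof. by rewrite -{1}(consr0 x y) coord_le_norm. Qed.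

Lemma consr_normr n (x : R) (y : 'rV[R]_n) : `|y| <= `|consr x y|.
Proof.
by apply: norm_le_coord => // j; rewrite -(consrS x y j) coord_le_norm.
Qed.

Lemma continuous_consr n (x : R) : continuous (@consr n x).
Proof.
move=> y; rewrite (_ : consr x = vec (fun (k : 'I_n.+1) y =>
    if unlift ord0 k is Some j then y 0 j else x)).
  apply: continuous_vec => k; case: unlift => [j|]; last exact: cst_continuous.
  exact: coord_continuous.
by apply/funext => z; apply/rowP => k; rewrite !mxE.
Qed.

Lemma partial_compact_support n (F : 'rV[R]_n -> R) k M :
  (forall x, M < `|x| -> F x = 0) -> forall x, M < `|x| -> partial k F x = 0.
Proof.
move=> F0 x xM; rewrite /partial (@near_eq_derive _ _ _ F (cst 0)) ?derive_cst//.
have FF : Filter (nbhs x) by exact: nbhs_filter.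
near=> y; apply: F0; near: y.
by apply: (@cvgr_gt _ _ _ _ (fun y : 'rV[R]_n => `|y|)); [exact: norm_continuous|].
Unshelve. all: by end_near. Qed.


(** One step of the recursion that defines the measure, in the form to which
    Fubini's theorem applies: the first coordinate is the second component of the
    pair. *)
Lemma integral_lebesgue_tupleS n (f : 'rV[R]_n.+1 -> R) :
  (lebesgue_tuple R n.+1).-integrable setT (fun t => (f (tuple_row t))%:E) ->
  let g (z : tup n * measurableTypeR R) := (f (consr z.2 (tuple_row z.1)))%:E in
  (lebesgue_sf R n \x lebesgue_measure)%E.-integrable setT g /\
  (\int[lebesgue_tuple R n.+1]_t (f (tuple_row t))%:E =
   \int[lebesgue_sf R n \x lebesgue_measure]_z g z)%E.
Proof.
move=> If g.
have E : g = (fun t => (f (tuple_row t))%:E) \o @cons_pair R n.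
  by apply/funext => -[t x]; rewrite /g /= tuple_row_cons_pair.
have mf := measurable_int _ If.
have mabs : measurable_fun setT (abse \o (fun t : tup n.+1 => (f (tuple_row t))%:E)).
  exact: measurableT_comp.
have Ig : (lebesgue_sf R n \x lebesgue_measure)%E.-integrable setT g.
  rewrite E; apply/integrableP; split.
    by apply: measurableT_comp => //; exact: measurable_cons_pair.
  have /integrableP[_] := If; rewrite /= /lebesgue_step.
  have -> // := ge0_integral_pushforward (@measurable_cons_pair R n)
    (lebesgue_sf R n \x lebesgue_measure)%E measurableT mabs
    (fun _ _ => abse_ge0 _).
split => //; rewrite E.
have <- // := integral_pushforward (@measurable_cons_pair R n) mf _ measurableT.
by rewrite -E.
Qed.

(** By Fubini's theorem the integration in the variable [k] can be done first, and
    it gives 0 by the fundamental theorem of calculus. The induction follows the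
    recursive definition of the measure: either [k] is the first coordinate, or it
    is a coordinate of the remaining point. *)
Lemma integral_partial_eq0 n (k : 'I_n) (F : 'rV[R]_n -> R) (M : R) :
  (forall x, derivable F x (delta_mx 0 k)) -> continuous F ->
  continuous (partial k F) -> (forall x, M < `|x| -> F x = 0) ->
  (\int[lebesgue_tuple R n]_t (partial k F (tuple_row t))%:E = 0)%E.
Proof.
elim: n => [|n IH] in k F *; first by case: k.
move=> dF cF cdF F0.
have dF0 := partial_compact_support k F0.
have M'0 : 0 <= `|M| by [].
have MM' : M <= `|M| by exact: ler_norm.
have [C HC] := continuous_bounded_on_ball `|M| cdF.
have Ip : (lebesgue_tuple R n.+1).-integrable setT
    (fun t => (partial k F (tuple_row t))%:E).
  apply: (@integrable_compact_support _ (partial k F) `|M| C) => //.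
    exact: measurable_fun_row.
  by move=> x xM; apply: dF0; exact: le_lt_trans xM.
have [Ig ->] := integral_lebesgue_tupleS Ip.
have [j|] := unliftP ord0 k => Ek; subst k.
  rewrite -integral21_prod_meas1//= integral0_eq// => x _; rewrite /fubini_G /=.
  pose Fx (y : 'rV[R]_n) := F (consr x y).
  have Dx y : is_derive y (delta_mx 0 j) Fx (partial (lift ord0 j) F (consr x y)).
    have [h1 h2] := derivableP (dF (consr x y)).
    have E : (fun h : R => h^-1 *: (Fx (h *: delta_mx 0 j + y) - Fx y)) =
      (fun h => h^-1 *: (F (h *: delta_mx 0 (lift ord0 j) + consr x y) - F (consr x y))).
      by apply/funext => h; rewrite /Fx consr_tail.
    by apply: DeriveDef; rewrite /derivable /derive /= E.
  have pE : partial j Fx = partial (lift ord0 j) F \o consr x.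
    by apply/funext => y; case: (Dx y).
  have := IH j Fx _ _ _ _; rewrite pE /=; apply.
  - by move=> y; case: (Dx y).
  - by move=> y; apply: continuous_comp; [exact: continuous_consr|exact: cF].
  - by move=> y; apply: continuous_comp; [exact: continuous_consr|exact: cdF].
  - by move=> y yM; apply: F0; exact: lt_le_trans (consr_normr x y).
rewrite -integral12_prod_meas1//= integral0_eq// => t _; rewrite /fubini_F /=.
pose y := tuple_row t.
apply: (@integral_derive_eq0 (fun x => F (consr x y)) _ M).
- move=> x; have [h1 h2] := derivableP (dF (consr x y)).
  have E : (fun h : R => h^-1 *: (F (consr (h *: 1 + x) y) - F (consr x y))) =
      (fun h => h^-1 *: (F (h *: delta_mx 0 ord0 + consr x y) - F (consr x y))).
    by apply/funext => h; rewrite [h *: 1]mulr1 consr_head.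
  by apply: DeriveDef; rewrite /derivable /derive /= E.
- move=> x; apply: (@continuous_comp _ _ _ (fun x => consr x y) (partial ord0 F)).
    have -> : (fun x => consr x y) = (fun x : R => x *: delta_mx 0 ord0 + consr 0 y).
      by apply/funext => z; rewrite -consr_head addr0.
    by apply: continuousD; [exact: scalel_continuous|exact: cst_continuous].
  exact: cdF.
- move=> x xM; have xM' := lt_le_trans xM (consr_norml x y).
  by split; [exact: F0|exact: dF0].
Qed.

End integration.

Section integral_on_balls.
Context {R : realType} {n : nat}.
Local Notation mu := (lebesgue_tuple R n).

Lemma measurable_ball (r : R) : 0 < r ->
  measurable (@tuple_row R n @^-1` eball r).
Proof.
move=> r0; apply: measurable_open_row; rewrite eballE//.
apply: (@open_comp _ _ (@sqnorm R n) [set y | y < r ^+ 2]); last exact: open_lt.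
by move=> x _; apply: C1_continuous; exact: C1_sqnorm.
Qed.

Lemma ball_sub_cube (r : R) : 0 < r ->
  @tuple_row R n @^-1` eball r `<=` cube n r.
Proof.
move=> r0 t; rewrite eballE//= => tr k.
have := le_lt_trans (coord_sqr_le_sqnorm (tuple_row t) k) tr.
rewrite mxE -real_normK ?num_real// => h.
by rewrite -(@ler_pXn2r _ 2)// ?nnegrE// ltW.
Qed.

Lemma ball_integrable (f : 'rV[R]_n -> R) (r : R) : 0 < r -> continuous f ->
  mu.-integrable (@tuple_row R n @^-1` eball r) (EFin \o (fun t => f (tuple_row t))).
Proof.
move=> r0 cf; apply: (@integrableS _ _ _ _ (cube n r)).
- exact: measurable_cube.
- exact: measurable_ball.
- exact: ball_sub_cube.
have [C HC] := continuous_bounded_on_ball r cf.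
apply: measurable_bounded_integrable.
- exact: measurable_cube.
- exact: lebesgue_cube_lty.
- exact: measurable_funS (measurable_fun_row cf).
- exists C; split; first exact: num_real.
  move=> y Cy t tM; apply: le_trans (ltW Cy); apply: HC.
  by apply: norm_le_coord => [|k]; [exact: ltW|rewrite mxE; exact: tM].
Qed.

Lemma integral_on_supp (f : 'rV[R]_n -> R) (r : R) :
  (forall x, ~ eball r x -> f x = 0) ->
  integral_on (eball r) f = (\int[mu]_t f (tuple_row t))%R.
Proof.
move=> f0; rewrite /integral_on [LHS]Rintegral_mkcond; apply: eq_Rintegral => t _.
by rewrite patchE; case: ifPn => // /negP H; rewrite f0// => xr; apply: H; rewrite inE.
Qed.

Lemma integral_on_lin (f g : 'rV[R]_n -> R) (r a b : R) : 0 < r ->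
  continuous f -> continuous g ->
  integral_on (eball r) (fun x => a * f x + b * g x) =
  a * integral_on (eball r) f + b * integral_on (eball r) g.
Proof.
move=> r0 cf cg; have mD := measurable_ball r0.
have If := ball_integrable r0 cf; have Ig := ball_integrable r0 cg.
rewrite /integral_on RintegralD//; first by rewrite !RintegralZl.
  have ca : continuous (fun x => a * f x).
    by apply: continuous_mul => // x; exact: cst_continuous.
  exact: (ball_integrable r0 ca).
have cb : continuous (fun x => b * g x).
  by apply: continuous_mul => // x; exact: cst_continuous.
exact: (ball_integrable r0 cb).
Qed.

End integral_on_balls.

(** * Monotonicity for divergence-free tensors *)

Section cutoff.
Context {R : realType}.

Lemma is_derive_sqr_max (y : R) :
  is_derive y 1 (fun y : R => Num.max 0 y ^+ 2) (2 * Num.max 0 y).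
Proof.
apply: is_derive_approx => e e0; exists e => // h he.
(* the error of the linear approximation is at most [h^2] *)
apply: (@le_trans _ _ (`|h| * `|h|)); last by rewrite ler_wpM2r// ltW.
rewrite [h *: 1]mulr1 -normrM.
rewrite [leRHS]ger0_norm -?expr2 ?sqr_ge0//.
by case: (leP 0 (h + y)) => a; case: (leP 0 y) => b; rewrite ler_norml; nra.
Qed.

(** The positive part is squared to make the function C1. As [N] grows the cutoffs
    tend to 1 on the half-open unit interval and stay 0 from 1 on, so that at
    [s = |x|^2 / r^2] they tend to the indicator of the open ball of radius [r]. *)
Definition cutoff N (s : R) : R := Num.max 0 (1 - s ^+ N.+1) ^+ 2.
Definition cutoff' N (s : R) : R :=
  2 * Num.max 0 (1 - s ^+ N.+1) * - (N.+1%:R * s ^+ N).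

Lemma is_derive_cutoff N (s : R) : is_derive s 1 (cutoff N) (cutoff' N s).
Proof.
apply: (@is_derive_comp1 R R (fun y : R => Num.max 0 y ^+ 2)
  (fun s : R => 1 - s ^+ N.+1) s 1 (2 * Num.max 0 (1 - s ^+ N.+1))).
  exact: is_derive_sqr_max.
have [D E] : is_derive s 1 (fun s : R => s ^+ N.+1) (N.+1%:R * s ^+ N).
  apply: DeriveDef; first exact: exprn_derivable.
  by rewrite exp_derive [_ *: 1]mulr1.
apply: (is_derive_eq (is_deriveB (is_derive_cst (1 : R) s 1) (DeriveDef D E))).
by rewrite sub0r.
Qed.

Lemma cutoff_ge0 N s : 0 <= cutoff N s.
Proof. exact: sqr_ge0. Qed.

Lemma cutoff_le1 N s : 0 <= s -> cutoff N s <= 1.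
Proof.
move=> s0; rewrite exprn_ile1// ?le_max ?lexx// ge_max ler01/=.
by rewrite lerBlDr lerDl exprn_ge0.
Qed.

Lemma cutoff_eq0 N s : 1 <= s -> cutoff N s = 0 /\ cutoff' N s = 0.
Proof.
move=> s1; rewrite /cutoff /cutoff'.
have H : 1 - s ^+ N.+1 <= 0 by rewrite subr_le0 exprn_ege1.
by rewrite max_l// expr0n/= mulr0 mul0r.
Qed.

Lemma cutoff'_le0 N s : 0 <= s -> cutoff' N s <= 0.
Proof.
move=> s0; rewrite /cutoff' mulrN oppr_le0 mulr_ge0//.
  by rewrite mulr_ge0// le_max lexx.
by rewrite mulr_ge0// exprn_ge0.
Qed.

(** The derivative in [r] of [cutoff N (|x|^2 / r^2)] is [- 2 / r] times such a
    product, hence bounded uniformly in [x]. *)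
Lemma cutoff'_bound N s : 0 <= s -> s * `|cutoff' N s| <= 2 * N.+1%:R.
Proof.
move=> s0; have [s1|s1] := leP 1 s.
  by have [_ ->] := cutoff_eq0 N s1; rewrite normr0 mulr0 mulr_ge0.
rewrite ler0_norm ?cutoff'_le0// /cutoff' !mulrN opprK.
have a0 := exprn_ge0 N.+1 s0; have b0 := exprn_ge0 N s0.
have b1 : s ^+ N <= 1 by rewrite exprn_ile1// ltW.
rewrite max_r; last by rewrite subr_ge0 exprn_ile1// ltW.
have -> : s * (2 * (1 - s ^+ N.+1) * (N.+1%:R * s ^+ N)) =
   2 * N.+1%:R * (s * ((1 - s ^+ N.+1) * s ^+ N)) by ring.
have X1 : s ^+ N.+1 <= 1 by rewrite exprn_ile1// ltW.
have Y0 : 0 <= 1 - s ^+ N.+1 by rewrite subr_ge0.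
have Y1 : 1 - s ^+ N.+1 <= 1 by rewrite lerBlDr lerDl.
rewrite ler_piMr ?mulr_ge0//; apply: mulr_ile1 => //; first exact: mulr_ge0.
  exact: ltW.
exact: mulr_ile1.
Qed.

Lemma continuous_cutoff' N : continuous (cutoff' N).
Proof.
have cX k : continuous (fun s : R => s ^+ k).
  by move=> s; exact: exprn_continuous.
(* twice the positive part, as a sum of continuous functions *)
pose h (y : R) : R := y + `|y|.
have ch : continuous h.
  by move=> y; apply: continuousD; [exact: cvg_id|exact: norm_continuous].
have -> : cutoff' N = (h \o (cst 1 - (fun s : R => s ^+ N.+1))) *
    (cst (- N.+1%:R) * (fun s : R => s ^+ N)).
  apply/funext => z; rewrite /cutoff' !fctE /= /h; set y := 1 - _.
  rewrite mulNr; congr (_ * _).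
  by case: (leP 0 y) => a; [rewrite ger0_norm//|rewrite ltr0_norm//]; ring.
move=> s; apply: continuousM.
  apply: continuous_comp; last exact: ch.
  by apply: continuousB; [exact: cst_continuous|exact: cX].
by apply: continuousM; [exact: cst_continuous|exact: cX].
Qed.

Lemma cvg_cutoff s : 0 <= s < 1 -> cutoff N s @[N --> \oo] --> (1 : R).
Proof.
move=> /andP[s0 s1].
have H : s ^+ N.+1 @[N --> \oo] --> (0 : R).
  by rewrite (@cvg_shiftS _ (fun N => s ^+ N)); apply: cvg_expr; rewrite ger0_norm.
rewrite (_ : (fun N => cutoff N s) = (fun N => (1 - s ^+ N.+1) * (1 - s ^+ N.+1))).
  have H1 : 1 - s ^+ N.+1 @[N --> \oo] --> (1 - 0 : R).
    by apply: cvgB H; exact: cvg_cst.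
  suff: (1 - s ^+ N.+1) * (1 - s ^+ N.+1) @[N --> \oo] --> ((1 - 0) * (1 - 0) : R).
    by rewrite subr0 mulr1.
  exact: (cvgM H1 H1).
apply/funext => N; rewrite /cutoff max_r ?expr2//.
by rewrite subr_ge0 exprn_ile1// ltW.
Qed.

End cutoff.

Section monotonicity.
Context {R : realType} {n : nat}.
Variables (T : 'I_n -> 'I_n -> 'rV[R]_n -> R) (e : 'rV[R]_n -> R) (alpha : R).
Hypothesis C1T : forall j k, C1 (T j k).
Hypothesis divT : forall k x, \sum_j partial j (T j k) x = 0.
Hypothesis ce : continuous e.
Hypothesis e_ge0 : forall x, 0 <= e x.
(** The model is [T = P - e I] with [P] positive semi-definite of trace at most
    [alpha e]; these are its consequences in the radial direction and for the trace. *)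
Hypothesis T_radial : forall x,
  - (e x * sqnorm x) <= \sum_j \sum_k T j k x * (x 0 j * x 0 k).
Hypothesis T_trace : forall x, \sum_k T k k x <= (alpha - n%:R) * e x.

Local Notation mu := (lebesgue_tuple R n).

(** The equation [div T = 0] is integrated against the field [w(|x|^2) x], whose
    derivative is [w I + 2 w' x x^T]: the bound on the trace is used with [w >= 0]
    and the bound in the radial direction with [w' <= 0]. *)
Lemma radial_test (w dw : R -> R) (S : R) : 0 <= S ->
  (forall s : R, is_derive s 1 w (dw s)) -> continuous dw ->
  (forall s, 0 <= s -> 0 <= w s /\ dw s <= 0) ->
  (forall s, S <= s -> w s = 0 /\ dw s = 0) ->
  0 <= (\int[mu]_t (((alpha - n%:R) * w (sqnorm (tuple_row t)) -
    2 * (sqnorm (tuple_row t) * dw (sqnorm (tuple_row t)))) * e (tuple_row t)))%R.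
Proof.
move=> S0 Dw cdw w_sign w_supp.
pose h (x : 'rV[R]_n) := (alpha - n%:R) * w (sqnorm x) - 2 * (sqnorm x * dw (sqnorm x)).
rewrite -[leRHS]/(\int[mu]_t (h (tuple_row t) * e (tuple_row t)))%R.
have Cw : C1 (fun x : 'rV[R]_n => w (sqnorm x)) by exact: (C1_comp1 Dw cdw C1_sqnorm).
have csq : continuous (@sqnorm R n) by exact: C1_continuous C1_sqnorm.
pose F (p : 'I_n * 'I_n) x := T p.1 p.2 x * (w (sqnorm x) * x 0 p.2).
pose D (p : 'I_n * 'I_n) := partial p.1 (F p).
have CF p : C1 (F p).
  by apply: C1M; [exact: C1T|apply: C1M => //; exact: C1_coord].
have DE p x : D p x = T p.1 p.2 x * (w (sqnorm x) * (p.2 == p.1)%:R +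
      x 0 p.2 * (dw (sqnorm x) * (2 * x 0 p.1))) +
    w (sqnorm x) * x 0 p.2 * partial p.1 (T p.1 p.2) x.
  have [_ <-//] : is_derive x (delta_mx 0 p.1) (F p)
      (T p.1 p.2 x * (w (sqnorm x) * (p.2 == p.1)%:R +
      x 0 p.2 * (dw (sqnorm x) * (2 * x 0 p.1))) +
      w (sqnorm x) * x 0 p.2 * partial p.1 (T p.1 p.2) x).
  apply: is_deriveM; first exact: C1_is_derive.
  apply: is_deriveM; last exact: is_derive_coord.
  by apply: is_derive_comp1; exact: is_derive_sqnorm.
have supp x : S + 1 < `|x| -> w (sqnorm x) = 0 /\ dw (sqnorm x) = 0.
  by move=> xS; apply: w_supp; apply/ltW/sqnorm_gt.
have F_supp p x : S + 1 < `|x| -> F p x = 0.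
  by move=> /supp[w0 _]; rewrite /F w0 mul0r mulr0.
have ID p : mu.-integrable setT (EFin \o (fun t => D p (tuple_row t))).
  apply: (@integrable_continuous_compact_support _ _ (D p) (S + 1)).
    exact: (C1_partial_continuous (k := p.1) (CF p)).
  by move=> x; apply: (@partial_compact_support _ _ (F p)); exact: F_supp.
have int0 : (\int[mu]_t \sum_p (D p (tuple_row t))%:E = 0)%E.
  rewrite integral_sum//= big1// => p _.
  apply: (@integral_partial_eq0 _ _ _ (F p) (S + 1)).
  - by move=> x; case: (CF p p.1).
  - exact: C1_continuous.
  - exact: (C1_partial_continuous (k := p.1) (CF p)).
  - exact: F_supp.
have cdwsq : continuous (fun x : 'rV[R]_n => dw (sqnorm x)).
  by move=> x; apply: (@continuous_comp _ _ _ _ dw); [exact: csq|exact: cdw].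
have cwsq := C1_continuous Cw.
have ch : continuous (fun x => h x * e x).
  apply: continuous_mul => //; apply: continuous_sub; apply: continuous_mul => //.
  - by move=> x; exact: cst_continuous.
  - by move=> x; exact: cst_continuous.
  - exact: continuous_mul.
have Ih : mu.-integrable setT (EFin \o (fun t => h (tuple_row t) * e (tuple_row t))).
  apply: (@integrable_continuous_compact_support _ _ (fun x => h x * e x) (S + 1)) => // x.
  by move=> /supp[w0 dw0]; rewrite /h w0 dw0 !mulr0 subrr mul0r.
have IS : mu.-integrable setT (EFin \o (fun t => \sum_p D p (tuple_row t))).
  rewrite (_ : _ \o _ = fun t => (\sum_p (EFin \o (fun t => D p (tuple_row t))) t)%E).
    by apply: integrable_sum.
  by apply/funext => t /=; rewrite sumEFin.
have <- : (\int[mu]_t \sum_p D p (tuple_row t))%R = 0.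
  rewrite /Rintegral; under eq_integral do rewrite -sumEFin.
  by rewrite int0.
apply: le_Rintegral => // t _; set x := tuple_row t.
have -> : \sum_p D p x = 2 * dw (sqnorm x) * (\sum_j \sum_k T j k x * (x 0 j * x 0 k)) +
    w (sqnorm x) * \sum_k T k k x.
  under eq_bigr do rewrite DE.
  rewrite -(pair_bigA _ (fun j k => T j k x * (w (sqnorm x) * (k == j)%:R +
      x 0 k * (dw (sqnorm x) * (2 * x 0 j))) +
      w (sqnorm x) * x 0 k * partial j (T j k) x))/=.
  under eq_bigr do rewrite big_split/=.
  rewrite big_split/= [X in _ + X]exchange_big/= [X in _ + X]big1 ?addr0; last first.
    by move=> k _; rewrite -mulr_sumr divT mulr0.
  rewrite !mulr_sumr -big_split/=; apply: eq_bigr => j _.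
  rewrite mulr_sumr (bigD1 j)//= [in RHS](bigD1 j)//= eqxx.
  rewrite mulr1 (eq_bigr (fun k => 2 * dw (sqnorm x) * (T j k x * (x 0 j * x 0 k)))).
    by ring.
  by move=> k /negbTE -> /=; ring.
have [w0 dw0] := w_sign _ (sqnorm_ge0 x).
have h1 := ler_wnM2l dw0 (T_radial x).
have h2 := ler_wpM2l w0 (T_trace x).
rewrite /h; nra.
Qed.

Let truncated N (r : R) (x : 'rV[R]_n) := cutoff N (sqnorm x * r ^- 2) * e x.
Let truncated' N (r : R) (x : 'rV[R]_n) :=
  cutoff' N (sqnorm x * r ^- 2) * (sqnorm x * (- 2 * r ^- 3)) * e x.

Let scaled_ge1 (r : R) (x : 'rV[R]_n) : 0 < r -> ~ eball r x -> 1 <= sqnorm x * r ^- 2.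
Proof.
move=> r0; rewrite eballE//= => /negP; rewrite -leNgt => H.
by rewrite ler_pdivlMr ?exprn_gt0// mul1r.
Qed.

Let scaled_ge0 (r : R) (x : 'rV[R]_n) : 0 < r -> 0 <= sqnorm x * r ^- 2.
Proof. by move=> r0; rewrite mulr_ge0 ?sqnorm_ge0// invr_ge0 exprn_ge0// ltW. Qed.

Let eball_mono (r v : R) (x : 'rV[R]_n) : r <= v -> ~ eball v x -> ~ eball r x.
Proof. by move=> rv xv xr; apply: xv; exact: lt_le_trans xr rv. Qed.

Let truncated_supp N (r v : R) x : 0 < r <= v -> ~ eball v x ->
  truncated N r x = 0 /\ truncated' N r x = 0.
Proof.
move=> /andP[r0 rv] xv; rewrite /truncated /truncated'.
have [-> ->] := cutoff_eq0 N (scaled_ge1 r0 (eball_mono rv xv)).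
by rewrite !mul0r.
Qed.

Let is_derive_truncated N (r : R) x : 0 < r ->
  is_derive r 1 (fun r => truncated N r x) (truncated' N r x).
Proof.
move=> r0.
have D2 : is_derive r 1 (fun r : R => r ^- 2) (- 2 * r ^- 3).
  have [D E] : is_derive r 1 (fun r : R => r ^+ 2) (2 * r).
    apply: DeriveDef; first exact: exprn_derivable.
    by rewrite exp_derive [_ *: 1]mulr1.
  have r2 : r ^+ 2 != 0 by rewrite expf_neq0// gt_eqF.
  apply: DeriveDef; first exact: (derivableV (f := fun r : R => r ^+ 2)).
  rewrite (deriveV (f := fun r : R => r ^+ 2))// E /GRing.scale/=; field.
  by rewrite gt_eqF.
have D3 : is_derive r 1 (fun r : R => cutoff N (sqnorm x * r ^- 2))
    (cutoff' N (sqnorm x * r ^- 2) * (sqnorm x * (- 2 * r ^- 3))).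
  apply: (@is_derive_comp1 R R (cutoff N) (fun r : R => sqnorm x * r ^- 2)).
    exact: is_derive_cutoff.
have := is_deriveM D3 (is_derive_cst (e x) r 1).
move=> D4; apply: (is_derive_eq D4).
by rewrite /truncated' scaler0 add0r [LHS]mulrC.
Qed.

Let csq : continuous (@sqnorm R n).
Proof. exact: C1_continuous C1_sqnorm. Qed.

Let continuous_scaled (h : R -> R) (r : R) : continuous h ->
  continuous (fun x : 'rV[R]_n => h (sqnorm x * r ^- 2)).
Proof.
move=> ch x; apply: (@continuous_comp _ _ _ (fun x : 'rV[R]_n => sqnorm x * r ^- 2) h).
  by apply: continuous_mul => // y; exact: cst_continuous.
exact: ch.
Qed.

Let ccutoff N : continuous (@cutoff R N).
Proof.
move=> s; apply: differentiable_continuous; apply/derivable1_diffP.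
by case: (is_derive_cutoff N s).
Qed.

Let ctruncated N r : continuous (truncated N r).
Proof. by apply: continuous_mul => //; apply: continuous_scaled. Qed.

Let ctruncated' N r : continuous (truncated' N r).
Proof.
apply: continuous_mul => //; apply: continuous_mul.
  by apply: continuous_scaled; exact: continuous_cutoff'.
by apply: continuous_mul => // x; exact: cst_continuous.
Qed.

Let total N r := (\int[mu]_t truncated N r (tuple_row t))%R.

Let total_on N r v : 0 < r <= v -> total N r = integral_on (eball v) (truncated N r).
Proof.
by move=> rv; rewrite integral_on_supp// => x xv; have [] := truncated_supp N rv xv.
Qed.

(** The derivative is taken under the integral sign; for radii between [r / 2] and
    [2 r] everything happens in the ball of radius [2 r], where a multiple of [e]
    dominates. *)
Let is_derive_total N (r : R) : 0 < r ->
  is_derive r 1 (total N) (integral_on (eball (r + r)) (truncated' N r)).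
Proof.
move=> r0; pose v := r + r; pose u := r / 2.
have v0 : 0 < v by rewrite addr_gt0.
have u0 : 0 < u by rewrite divr_gt0.
pose D := @tuple_row R n @^-1` eball v.
pose f r t := truncated N r (tuple_row t).
have ruv : `]u, v[%classic r by rewrite /= in_itv/= /u /v; lra.
have d1f s t : 0 < s -> partial1of2 f s t = truncated' N s (tuple_row t).
  by move=> s0; rewrite partial1of2E; case: (is_derive_truncated N (tuple_row t) s0).
pose C : R := 4 * N.+1%:R * u^-1.
have C0 : 0 <= C by rewrite /C !mulr_ge0// invr_ge0 ltW.
have mD : measurable D by exact: measurable_ball.
have If s : `]u, v[%classic s -> mu.-integrable D (EFin \o f s).
  by move=> _; exact: (ball_integrable v0 (@ctruncated N s)).
have Df s t : `]u, v[%classic s -> D t -> derivable (f ^~ t) s 1.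
  rewrite /= in_itv/= => /andP[us _] _.
  by case: (is_derive_truncated N (tuple_row t) (lt_trans u0 us)).
have IG : mu.-integrable D (EFin \o (fun t => C * e (tuple_row t))).
  apply: (ball_integrable (f := fun x => C * e x)) => //.
  by apply: continuous_mul => // x; exact: cst_continuous.
have G0 (t : n.-tuple (measurableTypeR R)) : 0 <= C * e (tuple_row t).
  by rewrite mulr_ge0.
have Gub s t : `]u, v[%classic s -> D t -> `|partial1of2 f s t| <= C * e (tuple_row t).
  rewrite /= in_itv/= => /andP[us sv] _; have s0 := lt_trans u0 us.
  rewrite d1f// /truncated'; set x := tuple_row t; set y := sqnorm x * s ^- 2.
  rewrite normrM (ger0_norm (e_ge0 _)) ler_wpM2r//.
  have -> : cutoff' N y * (sqnorm x * (- 2 * s ^- 3)) = y * cutoff' N y * (- 2 * s^-1).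
    by rewrite /y; field; rewrite gt_eqF.
  have y0 : 0 <= y by exact: scaled_ge0.
  have -> : `|y * cutoff' N y * (- 2 * s^-1)| = y * `|cutoff' N y| * (2 * s^-1).
    rewrite normrM (normrM y) (ger0_norm y0) mulNr normrN; congr (_ * _).
    by rewrite ger0_norm// mulr_ge0// invr_ge0 ltW.
  have -> : C = (2 * N.+1%:R) * (2 * u^-1) by rewrite /C; ring.
  apply: ler_pM => //.
  - by rewrite mulr_ge0.
  - by rewrite mulr_ge0// invr_ge0 ltW.
  - exact: cutoff'_bound.
  - by rewrite ler_pM2l// lef_pV2 ?posrE// ltW.
have D1 := derivable_under_integral mD ruv If Df G0 IG Gub.
have D2 := differentiation_under_integral mD ruv If Df G0 IG Gub.
apply: (@near_eq_is_derive _ _ _ (fun s => \int[mu]_(t in D) f s t)%R).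
  near=> s; have : s \in `]u, v[ by near: s; exact: near_in_itvoo.
  rewrite in_itv/= => /andP[us sv]; rewrite (@total_on N s v)//.
  by rewrite (lt_trans u0 us) ltW.
apply: DeriveDef => //; rewrite -derive1E D2 /integral_on.
by apply: eq_Rintegral => t _; rewrite d1f.
Unshelve. all: by end_near. Qed.

Let scaled_energy N (r : R) := r `^ (alpha - n%:R) * total N r.

(** With [b = alpha - n], the derivative is [r^(b - 1)] times the integral that
    [radial_test] shows to be nonnegative for [w s = cutoff N (s / r^2)]. *)
Let scaled_energy_derive N (r : R) : 0 < r ->
  exists2 d, 0 <= d & is_derive r 1 (scaled_energy N) d.
Proof.
move=> r0; pose b := alpha - n%:R; pose v := r + r.
have v0 : 0 < v by rewrite addr_gt0.
have rv : 0 < r <= v by rewrite r0 /v lerDl ltW.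
have Dp : is_derive r 1 (fun r : R => r `^ b) (b * r `^ (b - 1)).
  exact: is_derive1_powR.
have D := is_deriveM Dp (is_derive_total N r0).
have rb : r `^ b = r `^ (b - 1) * r.
  rewrite -[X in _ * X](powRr1 (ltW r0)) -powRD ?subrK//.
  by apply/implyP => _; rewrite gt_eqF.
exists (r `^ (b - 1) * (b * total N r + r * integral_on (eball v) (truncated' N r))); last first.
  by apply: (is_derive_eq D); rewrite rb /GRing.scale/=; ring.
rewrite mulr_ge0 ?powR_ge0// (total_on _ rv) -integral_on_lin//.
rewrite integral_on_supp; last first.
  by move=> x xv; have [-> ->] := truncated_supp N rv xv; rewrite !mulr0 addr0.
have Dw (s : R) : is_derive s 1 (fun s : R => cutoff N (s * r ^- 2))
    (cutoff' N (s * r ^- 2) * r ^- 2).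
  apply: (@is_derive_comp1 R R (cutoff N) (fun s : R => s * r ^- 2)).
    exact: is_derive_cutoff.
  have := is_deriveM (is_derive_id s 1) (is_derive_cst (r ^- 2) s 1).
  by move=> D0; apply: (is_derive_eq D0); rewrite /GRing.scale/= mulr0 add0r mulr1.
have r20 : 0 <= r ^- 2 by rewrite invr_ge0 exprn_ge0// ltW.
have := radial_test (S := r ^+ 2) _ Dw.
move=> /(_ _ _ _ _)/le_trans; apply.
- by rewrite exprn_ge0// ltW.
- apply: continuous_mul => [s|s]; last exact: cst_continuous.
  apply: (@continuous_comp _ _ _ (fun s : R => s * r ^- 2) (cutoff' N)).
    by apply: continuous_mul s => // s; [exact: cvg_id|exact: cst_continuous].
  exact: continuous_cutoff'.
- move=> s s0; split; first exact: cutoff_ge0.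
  by rewrite mulr_le0_ge0// cutoff'_le0// mulr_ge0.
- move=> s rs; have [|-> ->] := @cutoff_eq0 R N (s * r ^- 2).
    by rewrite ler_pdivlMr ?exprn_gt0// mul1r.
  by rewrite mul0r.
rewrite le_eqVlt; apply/orP; left; apply/eqP; apply: eq_Rintegral => t _.
by rewrite /truncated /truncated' -/b; field; rewrite gt_eqF.
Qed.

Let scaled_energy_nondecreasing N (r s : R) : 0 < r -> r <= s ->
  scaled_energy N r <= scaled_energy N s.
Proof.
move=> r0 rs.
have H t : t \in `[r, s] -> exists2 d, 0 <= d & is_derive t 1 (scaled_energy N) d.
  rewrite in_itv/= => /andP[rt _].
  by apply: scaled_energy_derive; exact: lt_le_trans rt.
have cD : {within `[r, s], continuous (scaled_energy N)}.
  by apply: derivable_within_continuous => t /H[d _ []].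
have HD t : t \in `]r, s[ -> is_derive t 1 (scaled_energy N) ('D_1 (scaled_energy N) t).
  by move=> /subset_itv_oo_cc/H[d _ []] ? _; exact: derivableP.
have [c crs E] := MVT_segment rs HD cD.
rewrite -subr_ge0 E mulr_ge0 ?subr_ge0//.
by have [d d0 [_ ->]] := H c crs.
Qed.

(** On the ball of radius [r] the truncated densities are dominated by [e]. *)
Let cvg_total (r : R) : 0 < r ->
  total N r @[N --> \oo] --> integral_on (eball r) e.
Proof.
move=> r0; rewrite (_ : (fun N => total N r) =
    fun N => integral_on (eball r) (truncated N r)); last first.
  by apply/funext => N; apply: total_on; rewrite r0 lexx.
have mD := measurable_ball (n := n) r0.
rewrite /integral_on /Rintegral; apply: fine_cvg.
have Ie := ball_integrable r0 ce.
rewrite fineK; last exact: integrable_fin_num.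
apply: (@dominated_cvg _ _ _ _ _ mD
  (fun N t => (truncated N r (tuple_row t))%:E) _ (fun t => (e (tuple_row t))%:E)).
- by move=> N; exact: measurable_int (ball_integrable r0 (@ctruncated N r)).
- move=> t; rewrite /= eballE//= => tr.
  apply: cvg_EFin; first exact: nearW.
  rewrite /truncated -[X in _ --> X]mul1r; apply: cvgM; last exact: cvg_cst.
  apply: cvg_cutoff; rewrite scaled_ge0//=.
  by rewrite ltr_pdivrMr ?exprn_gt0// mul1r.
- by [].
- exact: Ie.
- move=> N t _; rewrite abse_EFin lee_fin /truncated normrM (ger0_norm (e_ge0 _)).
  rewrite ger0_norm ?cutoff_ge0// ler_piMl// cutoff_le1//; exact: scaled_ge0.
Qed.

Theorem monotonicity_of_stress_tensor : nondecreasing_on_pos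
  (fun r => (r `^ (n%:R - alpha))^-1 * integral_on (eball r) e).
Proof.
move=> r s; rewrite !in_itv/= !andbT => r0 s0 rs.
rewrite -!powRN !opprB.
have cvgE t : 0 < t -> scaled_energy N t @[N --> \oo] -->
    t `^ (alpha - n%:R) * integral_on (eball t) e.
  by move=> t0; apply: cvgM; [exact: cvg_cst|exact: (cvg_total t0)].
apply: ler_cvg_to (cvgE r r0) (cvgE s s0) _.
by apply: nearW => N; exact: scaled_energy_nondecreasing.
Qed.

End monotonicity.

(** * Densities of the gradient and their regularity at the origin *)

Section growth.
Context {R : realType} {n : nat}.
Implicit Types q : 'rV[R]_n.

(** As [om] vanishes at 0 and is continuous there, the bound makes [G] a [o(|q|)]. *)
Lemma is_derive_of_growth (G : 'rV[R]_n -> R) (om : R -> R) k :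
  G 0 = 0 -> (forall q, `|G q| <= Num.sqrt (sqnorm q) * om (sqnorm q)) ->
  om 0 = 0 -> {for 0, continuous om} -> is_derive 0 (delta_mx 0 k) G 0.
Proof.
move=> G0 Gom om0 com; apply: is_derive_approx => e e0.
have /cvgrPdist_le/(_ e e0)/nbhs_normP[d /= d0 Hd] := com.
exists (Num.min 1 d); first by rewrite lt_min ltr01.
move=> h; rewrite lt_min => /andP[h1 hd].
rewrite addr0 G0 subr0 mul0r subr0.
have E : sqnorm (h *: (delta_mx 0 k : 'rV[R]_n)) = h ^+ 2.
  rewrite /sqnorm (bigD1 k)//= big1 ?addr0 => [|j jk]; rewrite !mxE eqxx/=.
    by rewrite eqxx mulr1.
  by rewrite (negbTE jk) mulr0 expr0n.
apply: le_trans (Gom _) _; rewrite E sqrtr_sqr mulrC ler_wpM2r//.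
have h2 : `|0 - h ^+ 2| < d.
  rewrite sub0r normrN normrX; apply: le_lt_trans hd.
  by rewrite expr2 ler_piMl// ltW.
have := Hd _ h2; rewrite om0 sub0r normrN; exact: le_trans (ler_norm _).
Qed.

Lemma continuous_of_growth (g : 'rV[R]_n -> R) (om : R -> R) :
  g 0 = 0 -> (forall q, `|g q| <= om (sqnorm q)) ->
  om 0 = 0 -> {for 0, continuous om} -> {for 0, continuous g}.
Proof.
move=> g0 gom om0 com.
have c : om (sqnorm q) @[q --> (0 : 'rV[R]_n)] --> (0 : R).
  have cs : {for 0, continuous (@sqnorm R n)} by exact: (C1_continuous C1_sqnorm).
  have := @continuous_comp _ _ _ (@sqnorm R n) om 0 cs.
  by rewrite sqnorm0 => /(_ com); rewrite /prop_for /continuous_at /= sqnorm0 om0.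
pose F : set_system 'rV[R]_n := nbhs (0 : 'rV[R]_n).
have FF : Filter F by exact: nbhs_filter.
suff : g @ F --> g 0 by [].
rewrite g0; apply/cvgrPdist_le => e e0.
have H := proj1 (cvgrPdist_le _ _) c e e0.
near=> q; have h : `|0 - om (sqnorm q)| <= e by near: q; exact: H.
rewrite sub0r normrN; apply: le_trans (gom q) _.
by move: h; rewrite sub0r normrN; exact: le_trans (ler_norm _).
Unshelve. all: by end_near. Qed.

End growth.

Section profile.
Context {R : realType}.

(** [Phi] is a density as a function of the squared gradient [s]; [a] and [da] are
    its first two derivatives for [s > 0], and they may be singular at 0. The
    growth conditions are those under which [Phi(|q|^2)] and [a(|q|^2) q_j q_k] are
    [o(|q|)] and have first derivatives tending to 0 at the origin. *)
Record profile (Phi a da om : R -> R) : Prop := Profile {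
  profile0 : Phi 0 = 0;
  profile_derive : forall s : R, 0 < s -> is_derive s 1 Phi (a s);
  profile_derive2 : forall s : R, 0 < s -> is_derive s 1 a (da s);
  profile_continuous : forall s : R, 0 < s -> {for s, continuous da};
  profile_om0 : om 0 = 0;
  profile_com : {for 0, continuous om};
  profile_growth : forall s, 0 <= s -> `|Phi s| <= Num.sqrt s * om s;
  profile_growth1 : forall s, 0 <= s -> Num.sqrt s * `|a s| <= om s;
  profile_growth2 : forall s, 0 <= s -> s * (Num.sqrt s * `|da s|) <= om s }.

Section energy_density.
Context {n : nat} (Phi a da om : R -> R).
Hypothesis P : profile Phi a da om.
Implicit Types q : 'rV[R]_n.

(** The derivative of [a(|q|^2) q_j q_k] is a sum of four terms, each of them
    bounded by [om]. *)
Let om4 (s : R) := 4 * om s.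

Let om4_0 : om4 0 = 0. Proof. by rewrite /om4 (profile_om0 P) mulr0. Qed.

Let com4 : {for 0, continuous om4}.
Proof. by apply: continuousM (profile_com P); exact: cst_continuous. Qed.

Let om_ge0 s : 0 <= s -> 0 <= om s.
Proof. by move=> s0; rewrite (le_trans _ (profile_growth1 P s0))// mulr_ge0. Qed.

Let continuous_pos_comp (g : R -> R) q : q != 0 ->
  (forall s : R, 0 < s -> {for s, continuous g}) ->
  {for q, continuous (fun q => g (sqnorm q))}.
Proof.
move=> q0 cg; apply: (@continuous_comp _ _ _ (@sqnorm R n) g).
  by apply: C1_continuous; exact: C1_sqnorm.
exact/cg/sqnorm_gt0.
Qed.

Let ca (s : R) : 0 < s -> {for s, continuous a}.
Proof.
move=> s0; apply: differentiable_continuous; apply/derivable1_diffP.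
by case: (profile_derive2 P s0).
Qed.

Let ccoord (k : 'I_n) q : {for q, continuous (fun q => q 0 k)}.
Proof. exact: coord_continuous. Qed.

Lemma is_derive_density l q :
  is_derive q (delta_mx 0 l) (fun q => Phi (sqnorm q)) (2 * a (sqnorm q) * q 0 l).
Proof.
have [->|q0] := eqVneq q 0.
  rewrite mxE mulr0.
  apply: (@is_derive_of_growth _ _ (fun q => Phi (sqnorm q)) om) => [|q'||].
  - by rewrite sqnorm0 (profile0 P).
  - exact/(profile_growth P)/sqnorm_ge0.
  - exact: profile_om0 P.
  - exact: profile_com P.
have D := is_derive_comp1 (profile_derive P (sqnorm_gt0 q0)) (is_derive_sqnorm q l).
by apply: (is_derive_eq D); ring.
Qed.

Lemma C1_density : C1 (fun q => Phi (sqnorm q)).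
Proof.
apply: (C1_intro (df := fun l q => 2 * a (sqnorm q) * q 0 l)) => [l q|l q].
  exact: is_derive_density.
have [->|q0] := eqVneq q 0.
  apply: (@continuous_of_growth _ _ (fun q => 2 * a (sqnorm q) * q 0 l) om4) => //.
    by rewrite mxE mulr0.
  move=> q'; have N0 := sqnorm_ge0 q'.
  rewrite !normrM ger0_norm//.
  have h1 := profile_growth1 P N0; have h2 := om_ge0 N0.
  have h3 := ler_wpM2r (normr_ge0 (a (sqnorm q'))) (coord_le_sqrt_sqnorm q' l).
  by rewrite /om4; nra.
apply: (@continuousM _ _ (fun q => 2 * a (sqnorm q)) (fun q => q 0 l)) => //.
apply: (@continuousM _ _ (cst 2) (fun q => a (sqnorm q))); first exact: cst_continuous.
exact: continuous_pos_comp.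
Qed.

Let flux_flux j k q := a (sqnorm q) * (q 0 j * q 0 k).

Let dflux_flux j k l q := da (sqnorm q) * (2 * q 0 l) * (q 0 j * q 0 k) +
  a (sqnorm q) * (q 0 j * (k == l)%:R + q 0 k * (j == l)%:R).

Let flux_flux_growth j k q : `|flux_flux j k q| <= Num.sqrt (sqnorm q) * om (sqnorm q).
Proof.
have N0 := sqnorm_ge0 q.
rewrite /flux_flux !normrM.
have cj := coord_le_sqrt_sqnorm q j; have ck := coord_le_sqrt_sqnorm q k.
have h1 := profile_growth1 P N0.
apply: (@le_trans _ _ (`|a (sqnorm q)| * (Num.sqrt (sqnorm q) * Num.sqrt (sqnorm q)))).
  by rewrite ler_wpM2l// ler_pM.
by rewrite mulrCA ler_wpM2l ?sqrtr_ge0// mulrC.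
Qed.

Let dflux_flux_growth j k l q : `|dflux_flux j k l q| <= om4 (sqnorm q).
Proof.
have N0 := sqnorm_ge0 q; set N := sqnorm q; set r := Num.sqrt N.
have r0 : 0 <= r by exact: sqrtr_ge0.
have r2 : r * r = N by rewrite -expr2 sqr_sqrtr.
have cj := coord_le_sqrt_sqnorm q j; have ck := coord_le_sqrt_sqnorm q k.
have cl := coord_le_sqrt_sqnorm q l.
have h1 := profile_growth1 P N0; have h2 := profile_growth2 P N0.
have delta_le (c : R) (b : bool) : `|c * b%:R| <= `|c|.
  by case: b; rewrite ?mulr1 ?mulr0 ?normr0.
have b1 : `|da N * (2 * q 0 l) * (q 0 j * q 0 k)| <= 2 * om N.
  rewrite !normrM (ger0_norm (ler0n _ 2)).
  apply: (@le_trans _ _ (`|da N| * (2 * r) * (r * r))).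
    by rewrite ler_pM ?mulr_ge0// ?ler_pM// ler_wpM2l// ler_wpM2l.
  by rewrite r2; move: h2; rewrite -/N -/r; lra.
have b2 : `|a N * (q 0 j * (k == l)%:R + q 0 k * (j == l)%:R)| <= 2 * om N.
  rewrite normrM; apply: (@le_trans _ _ (`|a N| * (r + r))).
    rewrite ler_wpM2l// (le_trans (ler_normD _ _))// lerD//.
      exact: le_trans (delta_le _ _) cj.
    exact: le_trans (delta_le _ _) ck.
  by move: h1; rewrite -/N -/r; lra.
rewrite /dflux_flux /om4 (le_trans (ler_normD _ _))//.
have -> : 4 * om N = 2 * om N + 2 * om N by ring.
exact: lerD.
Qed.

Let dflux_flux0 j k l : dflux_flux j k l 0 = 0.
Proof. by rewrite /dflux_flux !mxE !mulr0 !mul0r addr0 mulr0 addr0. Qed.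

Let is_derive_flux_flux j k l q :
  is_derive q (delta_mx 0 l) (flux_flux j k) (dflux_flux j k l q).
Proof.
have [->|q0] := eqVneq q 0.
  rewrite dflux_flux0; apply: (@is_derive_of_growth _ _ (flux_flux j k) om).
  - by rewrite /flux_flux !mxE !mulr0.
  - exact: flux_flux_growth.
  - exact: profile_om0 P.
  - exact: profile_com P.
have D1 := is_derive_comp1 (profile_derive2 P (sqnorm_gt0 q0)) (is_derive_sqnorm q l).
have D2 := is_deriveM (is_derive_coord q j l) (is_derive_coord q k l).
apply: (is_derive_eq (is_deriveM D1 D2)).
by rewrite /dflux_flux /GRing.scale/= !fctE/=; ring.
Qed.

Let C1_flux_flux j k : C1 (flux_flux j k).
Proof.
apply: (C1_intro (df := dflux_flux j k)) => [l q|l q].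
  exact: is_derive_flux_flux.
have [->|q0] := eqVneq q 0.
  exact: (continuous_of_growth (dflux_flux0 j k l) (dflux_flux_growth j k l)).
have cc (c : R) : {for q, continuous (fun _ : 'rV[R]_n => c)} by exact: cst_continuous.
have cq i : {for q, continuous (fun q : 'rV[R]_n => q 0 i)} by exact: ccoord.
have cda := continuous_pos_comp q0 (profile_continuous P).
have ca' := continuous_pos_comp q0 ca.
exact: (continuousD
  (continuousM (continuousM cda (continuousM (cc 2) (cq l)))
    (continuousM (cq j) (cq k)))
  (continuousM ca'
    (continuousD (continuousM (cq j) (cc _)) (continuousM (cq k) (cc _))))).
Qed.

(** With [c = 1] and [q] the gradient, this is the stress tensor. Other values of
    [c] occur when the same tensor is written as a function of the flux. *)
Definition stress (c : R) (j k : 'I_n) q : R :=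
  2 * (a (sqnorm q) * (q 0 j * q 0 k)) - c * Phi (sqnorm q) * (j == k)%:R.

(** The coefficient [a] may be discontinuous at the origin, but the products in
    which it occurs are C1 there, with zero derivative, by the growth conditions. *)
Lemma C1_stress c j k : C1 (stress c j k).
Proof.
rewrite (_ : stress c j k = fun q => 2 * flux_flux j k q +
  (- c * (j == k)%:R) * Phi (sqnorm q)); last first.
  by apply/funext => q; rewrite /stress /flux_flux; ring.
exact: (C1D (C1M (C1_cst 2) (C1_flux_flux j k)) (C1M (C1_cst _) C1_density)).
Qed.

Lemma partial_stress0 c j k l : partial l (stress c j k) 0 = 0.
Proof.
have D1 := is_derive_flux_flux j k l 0; have D2 := is_derive_density l 0.
rewrite dflux_flux0 in D1; rewrite mxE mulr0 in D2.
have D := is_deriveD (is_deriveM (is_derive_cst (2 : R) (0 : 'rV[R]_n) (delta_mx 0 l)) D1)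
  (is_deriveM (is_derive_cst (- c * (j == k)%:R) (0 : 'rV[R]_n) (delta_mx 0 l)) D2).
rewrite !scaler0 !addr0 in D.
rewrite (_ : stress c j k = cst 2 * flux_flux j k +
  cst (- c * (j == k)%:R) * (fun q => Phi (sqnorm q))); first by case: D.
by apply/funext => q; rewrite /stress /flux_flux !fctE; ring.
Qed.

Lemma C1_stress_comp N c j k (W : 'I_n -> 'rV[R]_N -> R) : (forall l, C1 (W l)) ->
  C1 (fun y => stress c j k (vec W y)).
Proof. by move=> CW; apply: C1_comp => //; exact: C1_stress. Qed.

Lemma partial_stress_comp0 N c j k i (W : 'I_n -> 'rV[R]_N -> R) x :
  (forall l, C1 (W l)) -> vec W x = 0 ->
  partial i (fun y => stress c j k (vec W y)) x = 0.
Proof.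
move=> CW W0.
have [|_] := @is_derive_chain _ _ _ (stress c j k) W x (delta_mx 0 i)
    (fun l => partial i (W l) x) _ (fun l => C1_is_derive i x (CW l)).
  by apply: C1_differentiable; exact: C1_stress.
rewrite /partial => ->; apply: big1 => l _.
by rewrite W0 -[X in X * _]/(partial l (stress c j k) 0) partial_stress0 mul0r.
Qed.

End energy_density.
End profile.

(** * The stress tensor of one component *)

Section component.
Context {R : realType} {n : nat}.
Implicit Types u : 'rV[R]_n -> R.

(** The gradient as a family of functions, so that it can be composed with [vec]. *)
Definition dvec u : 'I_n -> 'rV[R]_n -> R := fun k => partial k u.

Lemma enorm_grad_sqr u x : enorm (grad u x) ^+ 2 = sqnorm (vec (dvec u) x).
Proof. by rewrite sqr_sqrtr// sqnorm_ge0. Qed.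

Lemma differentiable_sqnorm_vec m (W : 'I_m -> 'rV[R]_n -> R) x :
  (forall k, differentiable (W k) x) -> differentiable (fun y => sqnorm (vec W y)) x.
Proof.
move=> dW; have -> : (fun y => sqnorm (vec W y)) = \sum_k (W k * W k).
  by apply/funext => y; rewrite fct_sumE; apply: eq_bigr => k _; rewrite mxE.
by apply: differentiable_sum => k; exact: differentiableM.
Qed.

Lemma differentiable_radial m (W : 'I_m -> 'rV[R]_n -> R) (a : R -> R) (d : R) x k :
  (forall k, differentiable (W k) x) -> is_derive (sqnorm (vec W x)) 1 a d ->
  differentiable (fun y => a (sqnorm (vec W y)) * W k y) x.
Proof.
move=> dW [Da _]; apply: differentiableM => //.
apply: (@differentiable_comp _ _ _ _ (fun y => sqnorm (vec W y)) a).
  exact: differentiable_sqnorm_vec.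
exact/derivable1_diffP.
Qed.

Section regular_point.
Variables (u : 'rV[R]_n -> R) (V : 'I_n -> 'rV[R]_n -> R) (Phi a : R -> R).
Variable x : 'rV[R]_n.
Hypothesis Cu : C1 u.
Hypothesis du : forall k, differentiable (dvec u k) x.
Hypothesis dV : forall j, derivable (V j) x (delta_mx 0 j).
Hypothesis Vx : forall j, V j x = a (sqnorm (vec (dvec u) x)) * dvec u j x.
Hypothesis dPhi : is_derive (sqnorm (vec (dvec u) x)) 1 Phi (a (sqnorm (vec (dvec u) x))).

Let T j k y := 2 * (V j y * dvec u k y) - Phi (sqnorm (vec (dvec u) y)) * (j == k)%:R.

(** The second derivatives commute, so [sum_j 2 V_j d_j d_k u] is
    [sum_j 2 a d_j u d_k d_j u], the derivative of [Phi(|grad u|^2)] along [k]; the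
    two cancel in the divergence. *)
Lemma div_stress_regular k :
  \sum_j partial j (T j k) x = 2 * (\sum_j partial j (V j) x) * dvec u k x.
Proof.
have cross i j : partial i (dvec u j) x = partial j (dvec u i) x.
  by apply: schwarz; [case: (Cu j)|case: (Cu i)|exact: (du j)|exact: (du i)].
pose s := sqnorm (vec (dvec u) x).
have dN i : is_derive x (delta_mx 0 i) (fun y => sqnorm (vec (dvec u) y))
    (\sum_l 2 * dvec u l x * partial i (dvec u l) x).
  have D := @is_derive_chain _ _ _ (@sqnorm R n) (dvec u) x (delta_mx 0 i)
    (fun l => partial i (dvec u l) x) (C1_differentiable _ C1_sqnorm)
    (fun l => derivableP (diff_derivable (v := delta_mx 0 i) (du l))).
  apply: (is_derive_eq D); apply: eq_bigr => l _; congr (_ * _).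
  by have [_] := is_derive_sqnorm (vec (dvec u) x) l; rewrite mxE.
have dT j : partial j (T j k) x = 2 * (V j x * partial j (dvec u k) x +
     dvec u k x * partial j (V j) x) -
     a s * (\sum_l 2 * dvec u l x * partial j (dvec u l) x) * (j == k)%:R.
  have D1 := is_deriveM (derivableP (@dV j)) (derivableP (diff_derivable (v := delta_mx 0 j) (du k))).
  have D2 := is_derive_comp1 (f := fun y => sqnorm (vec (dvec u) y)) (x := x) dPhi (dN j).
  have D := is_deriveB (is_deriveM (is_derive_cst (2 : R) x (delta_mx 0 j)) D1)
     (is_deriveM D2 (is_derive_cst ((j == k)%:R : R) x (delta_mx 0 j))).
  have [_ D'] := D; rewrite [LHS]D' !scaler0 addr0 add0r /GRing.scale/=.
  by congr (_ - _); exact: mulrC.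
under eq_bigr do rewrite dT.
rewrite sumrB [X in _ - X](bigD1 k)//= [X in _ - (_ + X)]big1 ?addr0 => [|j /negbTE ->];
  last by rewrite mulr0.
rewrite eqxx mulr1 !mulr_sumr mulr_suml -sumrB; apply: eq_bigr => j _.
rewrite Vx (cross k j) -/s; ring.
Qed.

End regular_point.

(** What the proof needs of one component, independently of whether it comes from
    a C2 function or from a C1 flux. *)
Record noether_component (Phi a : R -> R) u (divV : 'rV[R]_n -> R) : Prop :=
  NoetherComponent {
    component_C1 : C1 u;
    component_stress_C1 : forall j k,
      C1 (fun y => stress Phi a 1 j k (vec (dvec u) y));
    component_div : forall k x,
      \sum_j partial j (fun y => stress Phi a 1 j k (vec (dvec u) y)) x =
      2 * divV x * dvec u k x }.

Lemma stressE (V : 'I_n -> 'rV[R]_n -> R) Phi a u :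
  (forall j y, V j y = a (sqnorm (vec (dvec u) y)) * dvec u j y) ->
  forall j k, (fun y => stress Phi a 1 j k (vec (dvec u) y)) =
    (fun y => 2 * (V j y * dvec u k y) - Phi (sqnorm (vec (dvec u) y)) * (j == k)%:R).
Proof.
move=> VE j k; apply/funext => y; rewrite VE /stress !mxE; ring.
Qed.

(** Where the gradient vanishes both sides are 0, since the stress tensor has zero
    derivative at the origin; elsewhere the density is differentiable and the
    computation at a regular point applies. *)
Lemma noether_component_gradient (Phi a da om : R -> R) u V :
  profile Phi a da om -> C2 u ->
  (forall j y, V j y = a (sqnorm (vec (dvec u) y)) * dvec u j y) ->
  (forall j x, derivable (V j) x (delta_mx 0 j)) ->
  noether_component Phi a u (fun x => \sum_j partial j (V j) x).
Proof.
move=> P [Cu C2u] VE dV; split => // [j k|k x].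
  exact: (C1_stress_comp P).
have [W0|W0] := eqVneq (vec (dvec u) x) 0.
  rewrite big1 => [|j _]; last exact: (partial_stress_comp0 P).
  by have /rowP/(_ k) := W0; rewrite !mxE => ->; rewrite mulr0.
under eq_bigr do rewrite (stressE Phi VE).
apply: (@div_stress_regular u V Phi a x) => //.
- by move=> l; exact: (C1_differentiable x (C2u l)).
- exact/(profile_derive P)/sqnorm_gt0.
Qed.

(** The coefficient [b] inverts the relation between gradient and flux, and
    [c Psi] is the density in terms of the flux: the stress tensor is then a C1
    function of the flux. Away from the zeros of the flux this also makes the
    first derivatives of [u] differentiable. *)
Lemma noether_component_flux (Phi a Psi b db om : R -> R) (c : R) u V :
  profile Psi b db om -> C1 u -> (forall j, C1 (V j)) ->
  (forall s : R, 0 < s -> is_derive s 1 Phi (a s)) ->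
  (forall j y, V j y = a (sqnorm (vec (dvec u) y)) * dvec u j y) ->
  (forall j y, dvec u j y = b (sqnorm (vec V y)) * V j y) ->
  (forall y, Phi (sqnorm (vec (dvec u) y)) = c * Psi (sqnorm (vec V y))) ->
  noether_component Phi a u (fun x => \sum_j partial j (V j) x).
Proof.
move=> P Cu CV dPhi VE uE PhiE.
have TE j k : (fun y => stress Phi a 1 j k (vec (dvec u) y)) =
    (fun y => stress Psi b c j k (vec V y)).
  apply/funext => y; rewrite /stress PhiE mul1r; congr (2 * _ - _).
  by rewrite !mxE [in LHS]mulrA -VE uE; ring.
split => // [j k|k x]; first by rewrite TE; exact: (C1_stress_comp P).
have [V0|V0] := eqVneq (vec V x) 0.
  rewrite big1 => [|j _]; last by rewrite TE; exact: (partial_stress_comp0 P).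
  by have /rowP/(_ k) := V0; rewrite uE !mxE => ->; rewrite !mulr0.
have W0 : vec (dvec u) x != 0.
  apply: contra V0 => /eqP W0; apply/eqP/rowP => j; rewrite !mxE VE.
  by have /rowP/(_ j) := W0; rewrite !mxE => ->; rewrite mulr0.
under eq_bigr do rewrite (stressE Phi VE).
apply: (@div_stress_regular u V Phi a x) => //.
- move=> l; rewrite (_ : dvec u l = fun y => b (sqnorm (vec V y)) * V l y); last exact/funext.
  apply: (@differentiable_radial _ V b (db (sqnorm (vec V x)))).
    by move=> j; exact: C1_differentiable.
  exact/(profile_derive2 P)/sqnorm_gt0.
- by move=> j; case: (CV j j).
- exact/dPhi/sqnorm_gt0.
Qed.

End component.

Section system.
Context {R : realType} {m n : nat}.

(** The sum of the stress tensors of the components becomes divergence free when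
    [2 Ht(u)] times the identity is added to it, since by the equations
    [grad (Ht(u))] is [- sum_i div V_i grad u_i]. *)
Theorem energy_nondecreasing (H : 'I_m -> 'rV[R]_m -> R) (Ht : 'rV[R]_m -> R)
    (u : 'I_m -> 'rV[R]_n -> R) (divV : 'I_m -> 'rV[R]_n -> R)
    (Phi a da om : R -> R) (alpha beta : R) :
  C1 Ht -> (forall i v, partial i Ht v = H i v) -> (forall v, Ht v <= 0) ->
  profile Phi a da om ->
  (forall s, 0 <= s -> 0 <= Phi s) -> (forall s, 0 <= s -> 0 <= a s) ->
  (forall s, 0 <= s -> 2 * (a s * s) <= beta * Phi s) ->
  beta <= alpha -> 0 <= alpha ->
  (forall i, noether_component Phi a (u i) (divV i)) ->
  (forall i x, - divV i x = H i (vec u x)) ->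
  nondecreasing_on_pos (energy Phi Ht u alpha).
Proof.
move=> CHt HtE Ht0 P Phi0 a0 aPhi ba alpha0 SC eqn.
pose N i x := sqnorm (vec (dvec (u i)) x).
have N0 i x : 0 <= N i x by exact: sqnorm_ge0.
pose e x := \sum_i Phi (N i x) - 2 * Ht (vec u x).
pose Ti i j k y := stress Phi a 1 j k (vec (dvec (u i)) y).
pose T j k y := \sum_i Ti i j k y + 2 * (j == k)%:R * Ht (vec u y).
have Cu i : C1 (u i) by exact: component_C1 (SC i).
have CHu : C1 (fun y => Ht (vec u y)) by exact: C1_comp.
have CTi j k : C1 (fun y => \sum_i Ti i j k y).
  by apply: C1_sum => i; exact: component_stress_C1 (SC i) j k.
have dHu k x : is_derive x (delta_mx 0 k) (fun y => Ht (vec u y))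
    (\sum_i H i (vec u x) * partial k (u i) x).
  have D := is_derive_chain (C1_differentiable (vec u x) CHt)
    (fun i => C1_is_derive k x (Cu i)).
  by apply: (is_derive_eq D); apply: eq_bigr => i _; rewrite HtE.
have eE : energy Phi Ht u alpha =
    (fun r => (r `^ (n%:R - alpha))^-1 * integral_on (eball r) e).
  apply/funext => r; rewrite /energy; congr (_ * integral_on _ _).
  by apply/funext => x; rewrite /e; under eq_bigr do rewrite enorm_grad_sqr.
rewrite eE.
apply: (@monotonicity_of_stress_tensor _ _ T e alpha).
- by move=> j k; apply: C1D => //; apply: C1M => //; exact: C1_cst.
- move=> k x.
  have dT j : partial j (T j k) x = \sum_i partial j (Ti i j k) x +
      2 * (j == k)%:R * \sum_i H i (vec u x) * partial j (u i) x.
    have D1 : is_derive x (delta_mx 0 j) (fun y => \sum_i Ti i j k y)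
        (\sum_i partial j (Ti i j k) x).
      have -> : (fun y => \sum_i Ti i j k y) = \sum_i Ti i j k.
        by apply/funext => y; rewrite fct_sumE.
      apply: is_derive_sum => i; apply: C1_is_derive.
      exact: component_stress_C1 (SC i) j k.
    have D := is_deriveD D1 (is_deriveM (is_derive_cst (2 * (j == k)%:R : R) x
      (delta_mx 0 j)) (dHu j x)).
    by have [_ D'] := D; rewrite [LHS]D' scaler0 addr0.
  under eq_bigr do rewrite dT.
  rewrite big_split/= exchange_big/= [X in _ + X](bigD1 k)//=.
  rewrite [X in _ + (_ + X)]big1 ?addr0 => [|j /negbTE ->]; last by rewrite mulr0 mul0r.
  rewrite eqxx mulr1 mulr_sumr -big_split/= big1// => i _.
  rewrite (component_div (SC i)) -eqn /dvec; ring.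
- have cPhi i : continuous (fun x => Phi (N i x)).
    move=> x; apply: (@continuous_comp _ _ _ (vec (dvec (u i))) (fun q => Phi (sqnorm q))).
      by apply: continuous_vec => k; case: (Cu i k) => _; exact.
    exact: (C1_continuous (C1_density P)).
  apply: continuous_sub; first by move=> x; apply: continuous_sumr => i; exact: cPhi.
  apply: continuous_mul; first by move=> x; exact: cst_continuous.
  exact: (C1_continuous CHu).
- move=> x; rewrite /e subr_ge0; apply: (@le_trans _ _ 0).
    by have := Ht0 (vec u x); lra.
  by apply: sumr_ge0 => i _; exact: Phi0.
- move=> x.
  have E i : \sum_j \sum_k Ti i j k x * (x 0 j * x 0 k) =
      2 * a (N i x) * (\sum_j dvec (u i) j x * x 0 j) ^+ 2 - Phi (N i x) * sqnorm x.
    rewrite expr2 mulr_suml mulr_sumr /sqnorm mulr_sumr -sumrB.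
    apply: eq_bigr => j _.
    rewrite mulr_sumr mulr_sumr [in LHS](bigD1 j)//= [in RHS](bigD1 j)//=.
    rewrite [X in _ + X = _](eq_bigr (fun k => 2 * a (N i x) *
      (dvec (u i) j x * x 0 j * (dvec (u i) k x * x 0 k)))).
      by rewrite /Ti /stress eqxx !mxE -/(N i x) /=; ring.
    move=> k; rewrite eq_sym => /negbTE jk; rewrite /Ti /stress jk !mxE -/(N i x) /=; ring.
  have -> : \sum_j \sum_k T j k x * (x 0 j * x 0 k) =
     \sum_i (\sum_j \sum_k Ti i j k x * (x 0 j * x 0 k)) + 2 * Ht (vec u x) * sqnorm x.
    rewrite [in RHS]exchange_big/= /sqnorm mulr_sumr -big_split/=; apply: eq_bigr => j _.
    rewrite [in RHS]exchange_big/= (bigD1 j)//= [in RHS](bigD1 j)//= /T eqxx.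
    rewrite [X in _ + X = _](eq_bigr (fun k => \sum_i Ti i j k x * (x 0 j * x 0 k))).
      by rewrite mulrDl mulr_suml /=; ring.
    by move=> k; rewrite eq_sym => /negbTE ->; rewrite mulr0 mul0r addr0 mulr_suml.
  under eq_bigr do rewrite E.
  rewrite sumrB -mulr_suml /e.
  have : 0 <= \sum_i 2 * a (N i x) * (\sum_j dvec (u i) j x * x 0 j) ^+ 2.
    by apply: sumr_ge0 => i _; rewrite mulr_ge0 ?sqr_ge0// mulr_ge0// a0.
  lra.
- move=> x.
  have E i : \sum_k Ti i k k x = 2 * (a (N i x) * N i x) - n%:R * Phi (N i x).
    rewrite /Ti /stress sumrB -!mulr_sumr.
    rewrite (eq_bigr (fun k => (dvec (u i) k x) ^+ 2)); last first.
      by move=> k _; rewrite !mxE expr2.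
    have -> : \sum_k dvec (u i) k x ^+ 2 = N i x.
      by apply: eq_bigr => k _; rewrite mxE.
    congr (_ - _); under eq_bigr do rewrite eqxx.
    by rewrite sumr_const card_ord mul1r mulrC.
  have -> : \sum_k T k k x = \sum_i (\sum_k Ti i k k x) + 2 * n%:R * Ht (vec u x).
    rewrite exchange_big/= big_split/=; congr (_ + _).
    under eq_bigr do rewrite eqxx/= mulr1.
    by rewrite sumr_const card_ord -mulr_natl; ring.
  under eq_bigr do rewrite E.
  rewrite sumrB -[X in _ - X]mulr_sumr.
  have h1 : \sum_i 2 * (a (N i x) * N i x) <= alpha * \sum_i Phi (N i x).
    rewrite mulr_sumr; apply: ler_sum => i _.
    by apply: le_trans (aPhi _ (N0 i x)) _; rewrite ler_wpM2r// Phi0.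
  have := mulr_ge0_le0 alpha0 (Ht0 (vec u x)).
  rewrite /e; lra.
Qed.

End system.

(** * The power and area densities *)

Section power_profile.
Context {R : realType}.
Implicit Types p s : R.

Definition power_density p s : R := 2 / p * s `^ (p / 2).
Definition power_coef p s : R := s `^ (2^-1 * (p - 2)).

Lemma powR_mul s x y : 0 < s -> s `^ x * s `^ y = s `^ (x + y).
Proof. by move=> s0; rewrite powRD// (gt_eqF s0) implybT. Qed.

Lemma sqrt_powR s : 0 < s -> Num.sqrt s = s `^ 2^-1.
Proof. by move=> s0; rewrite powR12_sqrt// ltW. Qed.

Lemma is_derive_power_coef p s : 0 < s -> is_derive s 1 (power_coef p)
  (2^-1 * (p - 2) * s `^ (2^-1 * (p - 2) - 1)).
Proof. by move=> s0; exact: is_derive1_powR. Qed.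

Lemma is_derive_power_density p s : p != 0 -> 0 < s ->
  is_derive s 1 (power_density p) (power_coef p s).
Proof.
move=> p0 s0.
have D := is_deriveM (is_derive_cst (2 / p : R) s 1) (is_derive1_powR (p / 2) s0).
apply: (is_derive_eq D); rewrite scaler0 addr0 /power_coef /GRing.scale/=.
have -> : p / 2 - 1 = 2^-1 * (p - 2) by field.
by field.
Qed.

(** The absolute value takes care of negative [s], where the real power is 1. *)
Lemma continuous_powR_norm0 (K g : R) : 0 < g ->
  {for 0, continuous (fun s : R => K * `|s| `^ g)}.
Proof.
move=> g0; apply: continuousM; first exact: cst_continuous.
suff : `|s| `^ g @[s --> (0 : R)] --> `|(0 : R)| `^ g by [].
rewrite normr0 powR0 ?gt_eqF//.
apply/cvgrPdist_lt => e e0.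
have H : \forall s \near (0 : R), `|s| < e `^ g^-1.
  by apply: nbhs0_lt; exact: powR_gt0.
near=> s.
rewrite sub0r normrN ger0_norm ?powR_ge0//.
have -> : e = (e `^ g^-1) `^ g by rewrite -powRrM mulVf ?gt_eqF// powRr1// ltW.
apply: gt0_ltr_powR => //; rewrite ?nnegrE ?powR_ge0//.
by near: s; exact: H.
Unshelve. all: by end_near. Qed.

(** The factor [2 + p] dominates the constants [2 / p], [1] and [|p - 2| / 2] of
    the three growth conditions. *)
Lemma power_profile p : 1 < p ->
  profile (power_density p) (power_coef p)
    (fun s => 2^-1 * (p - 2) * s `^ (2^-1 * (p - 2) - 1))
    (fun s => (2 + p) * `|s| `^ (2^-1 * (p - 1))).
Proof.
move=> p1; have p0 : 0 < p by lra.
have g0 : 0 < 2^-1 * (p - 1) by rewrite mulr_gt0// subr_gt0.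
have gn0 : 2^-1 * (p - 1) != 0 by rewrite gt_eqF.
have p2 : p / 2 != 0 by rewrite gt_eqF// divr_gt0.
have om_ge0 s : 0 <= (2 + p) * `|s| `^ (2^-1 * (p - 1)).
  by rewrite mulr_ge0 ?powR_ge0//; lra.
split.
- by rewrite /power_density powR0// mulr0.
- by move=> s; apply: is_derive_power_density; rewrite gt_eqF.
- exact: is_derive_power_coef.
- move=> s s0; apply: differentiable_continuous; apply/derivable1_diffP.
  have D := is_deriveM (is_derive_cst (2^-1 * (p - 2) : R) s 1)
    (is_derive1_powR (2^-1 * (p - 2) - 1) s0).
  by case: D.
- by rewrite normr0 powR0// mulr0.
- exact: continuous_powR_norm0.
- move=> s; rewrite le_eqVlt => /predU1P[<-|s0].
    by rewrite sqrtr0 mul0r /power_density powR0// mulr0 normr0.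
  rewrite sqrt_powR// /power_density ger0_norm ?mulr_ge0 ?powR_ge0//; last first.
    by rewrite invr_ge0 ltW.
  rewrite gtr0_norm// mulrCA powR_mul//.
  have -> : 2^-1 + 2^-1 * (p - 1) = p / 2 by field.
  rewrite ler_wpM2r ?powR_ge0// ler_pdivrMr//; nra.
- move=> s; rewrite le_eqVlt => /predU1P[<-|s0]; first by rewrite sqrtr0 mul0r.
  rewrite sqrt_powR// /power_coef ger0_norm ?powR_ge0// powR_mul//.
  have -> : 2^-1 + 2^-1 * (p - 2) = 2^-1 * (p - 1) by field.
  by rewrite gtr0_norm// ler_peMl ?powR_ge0//; lra.
- move=> s; rewrite le_eqVlt => /predU1P[<-|s0]; first by rewrite mul0r.
  rewrite sqrt_powR// normrM (ger0_norm (powR_ge0 _ _)) (gtr0_norm s0).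
  set c := `|2^-1 * _|; set b := _ - 1.
  have -> : s * (s `^ 2^-1 * (c * s `^ b)) = c * (s `^ 1 * s `^ 2^-1 * s `^ b).
    by rewrite powRr1 ?ltW//; ring.
  rewrite !powR_mul// /c /b.
  have -> : 1 + 2^-1 + (2^-1 * (p - 2) - 1) = 2^-1 * (p - 1) by field.
  rewrite ler_wpM2r ?powR_ge0// ler_norml; lra.
Qed.

End power_profile.

Section area_profile.
Context {R : realType}.

Definition area_density (s : R) : R := 2 * (Num.sqrt (1 + s) - 1).
Definition area_coef (s : R) : R := (Num.sqrt (1 + s))^-1.

Lemma sqrt1D_ge1 (s : R) : 0 <= s -> 1 <= Num.sqrt (1 + s).
Proof. by move=> s0; rewrite -[leLHS]sqrtr1 ler_sqrt ?lerDl// addr_ge0. Qed.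

Lemma is_derive_sqrt1D (s : R) : 0 <= s ->
  is_derive s 1 (fun s : R => Num.sqrt (1 + s)) (2 * Num.sqrt (1 + s))^-1.
Proof.
move=> s0; have s1 : 0 < 1 + s by rewrite ltr_pwDl.
have D : is_derive s 1 (fun s : R => 1 + s) 1.
  by apply: (is_derive_eq (is_deriveD (is_derive_cst (1 : R) s 1) (is_derive_id s 1))); rewrite add0r.
have := is_derive_comp1 (f := fun s : R => 1 + s) (is_derive1_sqrt s1) D.
by rewrite mulr1.
Qed.

Lemma is_derive_area_coef (s : R) : 0 <= s ->
  is_derive s 1 area_coef (- 2^-1 * (Num.sqrt (1 + s))^-1 ^+ 3).
Proof.
move=> s0; have h := sqrt1D_ge1 s0; have [D E] := is_derive_sqrt1D s0.
have n0 : Num.sqrt (1 + s) != 0 by rewrite gt_eqF//; lra.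
apply: DeriveDef; first exact: (derivableV (f := fun s : R => Num.sqrt (1 + s))).
rewrite (deriveV (f := fun s : R => Num.sqrt (1 + s)))// E /GRing.scale/=.
by field.
Qed.

Lemma area_profile :
  profile area_density area_coef
    (fun s => - 2^-1 * (Num.sqrt (1 + s))^-1 ^+ 3) (@Num.sqrt R).
Proof.
have sq (s : R) : 0 <= s -> Num.sqrt (1 + s) * Num.sqrt (1 + s) = 1 + s.
  by move=> s0; rewrite -expr2 sqr_sqrtr// addr_ge0.
split.
- by rewrite /area_density addr0 sqrtr1 subrr mulr0.
- move=> s s0; have D := is_derive_sqrt1D (ltW s0).
  have D' := is_deriveM (is_derive_cst (2 : R) s 1) (is_deriveB D (is_derive_cst (1 : R) s 1)).
  apply: (is_derive_eq D'); rewrite scaler0 addr0 subr0 /area_coef /GRing.scale/=.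
  by have := sqrt1D_ge1 (ltW s0) => h; field; lra.
- by move=> s /ltW; exact: is_derive_area_coef.
- move=> s s0; have h := sqrt1D_ge1 (ltW s0).
  have cV : {for s, continuous (fun s : R => (Num.sqrt (1 + s))^-1)}.
    apply: continuousV; first by rewrite gt_eqF//; lra.
    apply: differentiable_continuous; apply/derivable1_diffP.
    by case: (is_derive_sqrt1D (ltW s0)).
  have c2 : {for s, continuous (fun _ : R => - 2^-1 : R)} by exact: cst_continuous.
  have cV3 := continuousM (continuousM cV cV) cV.
  rewrite (_ : (fun s => _) = (fun _ : R => - 2^-1 : R) *
    ((fun s : R => (Num.sqrt (1 + s))^-1) * (fun s : R => (Num.sqrt (1 + s))^-1) *
     (fun s : R => (Num.sqrt (1 + s))^-1))).
    exact: (continuousM c2 cV3).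
  by apply/funext => t; rewrite !fctE exprSr expr2.
- exact: sqrtr0.
- exact: sqrt_continuous.
- move=> s s0; have h := sqrt1D_ge1 s0; have h2 := sq s s0.
  rewrite -expr2 sqr_sqrtr// /area_density ger0_norm; first by nra.
  by rewrite mulr_ge0// subr_ge0.
- move=> s s0; have h := sqrt1D_ge1 s0.
  rewrite /area_coef ger0_norm ?invr_ge0 ?sqrtr_ge0// ler_piMr ?sqrtr_ge0//.
  by rewrite invf_le1//; lra.
- move=> s s0; have h := sqrt1D_ge1 s0; have h2 := sq s s0.
  rewrite mulrCA ler_piMr ?sqrtr_ge0// normrM normrN.
  set w := Num.sqrt (1 + s) in h h2 *.
  have w0 : 0 < w by lra.
  rewrite !ger0_norm ?exprn_ge0 ?invr_ge0//; last by lra.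
  rewrite exprVn mulrA ler_pdivrMr ?exprn_gt0// mul1r.
  have -> : w ^+ 3 = w * (w * w) by ring.
  by rewrite h2; nra.
Qed.

End area_profile.

(** * The three systems *)

Section instances.
Context {R : realType} {m n : nat}.
Variables (H : 'I_m -> 'rV[R]_m -> R) (Ht : 'rV[R]_m -> R).
Hypothesis hH : standing_assumption H.
Hypothesis hHt : is_potential Ht H.
Hypothesis Ht_le0 : forall v : 'rV[R]_m, Ht v <= 0.
Implicit Types u : 'I_m -> 'rV[R]_n -> R.

Let partial_Ht i v : partial i Ht v = H i v.
Proof. by have [_ <-] := hHt i v. Qed.

Let C1_Ht : C1 Ht.
Proof.
apply: (C1_intro (df := H)) => [k v|k]; first exact: hHt.
by apply: C1_continuous; case: hH.
Qed.

Lemma mean_curvature_energy_nondecreasing u alpha :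
  mean_curvature_solution H u -> 2 <= alpha ->
  nondecreasing_on_pos (energy area_density Ht u alpha).
Proof.
move=> Su a2; pose V i j y := mean_curvature_flux (u i) y 0 j.
have VE i j y : V i j y = area_coef (sqnorm (vec (dvec (u i)) y)) * dvec (u i) j y.
  by rewrite /V /mean_curvature_flux !mxE enorm_grad_sqr.
have dV i j x : derivable (V i j) x (delta_mx 0 j).
  have [[_ C2u] _] := Su i.
  rewrite (_ : V i j = fun y => area_coef (sqnorm (vec (dvec (u i)) y)) * dvec (u i) j y);
    last exact/funext.
  apply: diff_derivable.
  apply: (differentiable_radial j _ (is_derive_area_coef (sqnorm_ge0 _))) => k.
  exact: (C1_differentiable x (C2u k)).
have P := @area_profile R.
apply: (energy_nondecreasing (divV := fun i x => \sum_j partial j (V i j) x)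
  (beta := 2) C1_Ht partial_Ht Ht_le0 P) => //.
- by move=> s s0; rewrite mulr_ge0// subr_ge0 sqrt1D_ge1.
- by move=> s s0; rewrite invr_ge0 sqrtr_ge0.
- move=> s s0; have h := sqrt1D_ge1 s0; rewrite /area_density /area_coef.
  have h2 : Num.sqrt (1 + s) * Num.sqrt (1 + s) = 1 + s.
    by rewrite -expr2 sqr_sqrtr// addr_ge0.
  set w := Num.sqrt (1 + s) in h h2 *.
  have -> : s = w * w - 1 by rewrite h2; ring.
  have w0 : 0 < w by lra.
  rewrite ler_pM2l// mulrC ler_pdivrMr//; nra.
- by lra.
- by move=> i; have [C2u _] := Su i; exact: (noether_component_gradient P C2u (VE i)).
- by move=> i x; have [_ <-] := Su i.
Qed.

Lemma p_energy_nondecreasing p u alpha : 1 < p ->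
  p_laplace_solution p H u -> p <= alpha ->
  nondecreasing_on_pos (energy (power_density p) Ht u alpha).
Proof.
move=> p1 Su pa; have p0 : 0 < p by lra.
pose V i j y := p_flux p (u i) y 0 j.
pose N i y := sqnorm (vec (dvec (u i)) y).
have VE i j y : V i j y = power_coef p (N i y) * dvec (u i) j y.
  rewrite /V /p_flux !mxE /power_coef powRrM; congr (_ `^ _ * _).
  by rewrite powR12_sqrt// sqnorm_ge0.
have P := power_profile p1.
apply: (energy_nondecreasing (divV := fun i x => \sum_j partial j (V i j) x)
  (beta := p) C1_Ht partial_Ht Ht_le0 P) => //.
- by move=> s s0; rewrite /power_density mulr_ge0 ?powR_ge0// divr_ge0// ltW.
- by move=> s s0; exact: powR_ge0.
- move=> s; rewrite le_eqVlt => /predU1P[<-|s0].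
    by rewrite !mulr0 mulr_ge0 ?(ltW p0)// mulr_ge0 ?powR_ge0// divr_ge0// ltW.
  rewrite /power_coef /power_density -{2}(powRr1 (ltW s0)) powR_mul//.
  have -> : 2^-1 * (p - 2) + 1 = p / 2 by field.
  by rewrite le_eqVlt; apply/orP; left; apply/eqP; field; rewrite gt_eqF.
- by lra.
- move=> i; have [Cu reg dV _] := Su i; case: reg => [C2u|CV].
    exact: (noether_component_gradient P C2u (VE i) dV).
  (* for the conjugate exponent [p'] the gradient is [|V|^(p' - 2) V] *)
  pose p' := p / (p - 1).
  have pn1 : p - 1 != 0 by rewrite gt_eqF// subr_gt0.
  have p'1 : 1 < p' by rewrite /p' ltr_pdivlMr ?subr_gt0//; lra.
  have p'n0 : p' != 0 by rewrite gt_eqF//; lra.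
  have NVE y : sqnorm (vec (V i) y) = power_coef p (N i y) ^+ 2 * N i y.
    rewrite /sqnorm mulr_sumr; apply: eq_bigr => j _.
    by rewrite !mxE VE exprMn.
  have NVE' y : 0 < N i y -> sqnorm (vec (V i) y) = N i y `^ (p - 1).
    move=> Npos; rewrite NVE expr2 /power_coef powR_mul//.
    rewrite -[X in _ * X](powRr1 (ltW Npos)) powR_mul//.
    by have -> : 2^-1 * (p - 2) + 2^-1 * (p - 2) + 1 = p - 1 by field.
  have N0_coord y j : N i y = 0 -> dvec (u i) j y = 0.
    by move=> Ny0; have /rowP/(_ j) := sqnorm_eq0 Ny0; rewrite !mxE.
  apply: (@noether_component_flux _ _ _ _ _ _ _ _ (p' / p) (u i) (V i)
    (power_profile p'1)) => //.
  + by move=> s s0; apply: is_derive_power_density => //; rewrite gt_eqF.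
  + move=> j y; rewrite VE.
    have := sqnorm_ge0 (vec (dvec (u i)) y); rewrite le_eqVlt => /predU1P[N0|Npos].
      by rewrite N0_coord ?mulr0.
    rewrite NVE'// /power_coef -powRrM mulrA powR_mul//.
    have -> : (p - 1) * (2^-1 * (p' - 2)) + 2^-1 * (p - 2) = 0 by rewrite /p'; field.
    by rewrite powRr0 mul1r.
  + move=> y; rewrite -/(N i y).
    have := sqnorm_ge0 (vec (dvec (u i)) y); rewrite le_eqVlt => /predU1P[N0|Npos].
      rewrite NVE -[N i y]N0 mulr0 /power_density !powR0 ?mulr0//.
        by rewrite gt_eqF// divr_gt0//; lra.
      by rewrite gt_eqF// divr_gt0.
    rewrite NVE'// /power_density -powRrM.
    have -> : (p - 1) * (p' / 2) = p / 2 by rewrite /p'; field.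
    by field; rewrite p'n0 gt_eqF.
- by move=> i x; have [_ _ _ <-] := Su i.
Qed.

End instances.

Theorem corollary2p2 (R : realType) (m n : nat) (hm : (2 <= m)%N) (hn : (1 <= n)%N)
    (H : 'I_m -> 'rV[R]_m -> R) (Ht : 'rV[R]_m -> R)
    (hH : standing_assumption H) (hHt : is_potential Ht H)
    (Ht_le0 : forall v : 'rV[R]_m, Ht v <= 0) :
  (forall (u : 'I_m -> 'rV[R]_n -> R), laplace_solution H u ->
     forall alpha : R, 2 <= alpha ->
     nondecreasing_on_pos (energy (fun s : R => s) Ht u alpha)) /\
  (forall (u : 'I_m -> 'rV[R]_n -> R), mean_curvature_solution H u ->
     forall alpha : R, 2 <= alpha ->
     nondecreasing_on_pos
       (energy (fun s : R => 2 * (Num.sqrt (1 + s) - 1)) Ht u alpha)) /\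
  (forall p : R, 1 < p ->
   forall (u : 'I_m -> 'rV[R]_n -> R), p_laplace_solution p H u ->
     forall alpha : R, p <= alpha ->
     nondecreasing_on_pos
       (energy (fun s : R => 2 / p * s `^ (p / 2)) Ht u alpha)).
Proof.
split; last first.
  split => [u Su alpha alpha2|p p1 u Su alpha palpha].
    exact: (mean_curvature_energy_nondecreasing hH hHt Ht_le0 Su alpha2).
  exact: (p_energy_nondecreasing hH hHt Ht_le0 p1 Su palpha).
move=> u Su alpha alpha2.
(* the Laplacian is the p-Laplacian for [p = 2] *)
have flux2 i k : (fun y => p_flux 2 (u i) y 0 k) = partial k (u i).
  by apply/funext => y; rewrite /p_flux subrr powRr0 scale1r mxE.
have Su2 : p_laplace_solution 2 H u.
  move=> i; have [C2u eqn] := Su i; split.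
  - by case: C2u.
  - by left.
  - by move=> k x; rewrite flux2; have [_ /(_ k k)[]] := C2u.
  - move=> x; rewrite -eqn /divergence; congr (- _); apply: eq_bigr => k _.
    by rewrite flux2.
have lt12 : (1 : R) < 2 by lra.
have := p_energy_nondecreasing hH hHt Ht_le0 lt12 Su2 alpha2.
rewrite (_ : energy (power_density 2) Ht u alpha = energy (fun s => s) Ht u alpha)//.
apply/funext => r; rewrite /energy; congr (_ * integral_on _ _).
apply/funext => x; congr (_ - _); apply: eq_bigr => i _.
by rewrite /power_density divff ?mul1r ?powRr1 ?sqr_ge0.
Qed.
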